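(* Let $1\le p\le\infty$. The operator $\mathcal A_{g,p}:\mathcal D(\mathcal A_{g,p})\subset X_g^p\to L_g^p([a,b))$ is linear and closed. Its domain is precisely the set of states $([u],u_a,u_b)\in X_g^p$ that admit a representative in $\mathcal W_g^{1,p}([a,b])$ with the prescribed traces (i.e. some $U\in\mathcal W_g^{1,p}([a,b])$ with $U=u$ $\mu_g$-a.e., $U(a)=u_a$, $U(b)=u_b$), and $$\ker\mathcal A_{g,p}=\{([c],c,c):c\in\mathbb F\}.$$
   Context: Let $\mathbb F$ be $\mathbb R$ or $\mathbb C$, let $a<b$ be real, and let $g:[a,b]\to\mathbb R$ be nondecreasing and left-continuous. $\mu_g$ is the finite Lebesgue--Stieltjes measure on $[a,b)$ with $\mu_g([s,t))=g(t)-g(s)$ for $a\le s\le t\le b$. Standing assumption: $M_g:=\mu_g([a,b))=g(b)-g(a)>0$. For $1\le p\le\infty$, $L_g^p([a,b))$ is the $L^p$ space of $\mathbb F$-valued functions for the completion of $\mu_g$ (modulo $\mu_g$-a.e. equality); $[u]$ denotes the class of $u$. $J_g:=\{t\in[a,b):\Delta g(t):=g(t^+)-g(t)>0\}$ is the set of jump points, so $\mu_g(\{t\})=\Delta g(t)$ for $t\in J_g$. Conjugate exponents: $1/p+1/p'=1$, with $1'=\infty$, $\infty'=1$. $AC_g([a,b])$ is the set of $u:[a,b]\to\mathbb F$ such that for every $\varepsilon>0$ there is $\delta>0$ such that, for every finite family of pairwise disjoint intervals $[a_j,b_j)\subset[a,b)$, $\sum_j(g(b_j)-g(a_j))<\delta$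 implies $\sum_j|u(b_j)-u(a_j)|<\varepsilon$. It is known that $u\in AC_g([a,b])$ if and only if there is $v\in L_g^1([a,b))$ with $u(t)=u(a)+\int_{[a,t)}v\,d\mu_g$ for all $t\in[a,b]$; $v$ is unique $\mu_g$-a.e. and the Stieltjes derivative is $D_gu:=v$. $\mathcal W_g^{1,p}([a,b]):=\{U\in AC_g([a,b]): U|_{[a,b)}\in L_g^p([a,b)),\ D_gU\in L_g^p([a,b))\}$. Posterior trace: for $u\in AC_g([a,b])$, $S_gu(t):=u(t^+)$ if $t\in J_g$ and $S_gu(t):=u(t)$ if $t\notin J_g$. State space: $X_g^p:=L_g^p([a,b))\times\mathbb F^2$ with norm $\|([u],u_a,u_b)\|_{X_g^p}:=\|u\|_{L_g^p}+|u_a|+|u_b|$. Weak identity for $([u],u_a,u_b)\in X_g^p$ and $v\in L_g^p([a,b))$: for every $\Phi\in\mathcal W_g^{1,p'}([a,b])$, $$\int_{[a,b)}u\,D_g\Phi\,d\mu_g+\int_{[a,b)}v\,S_g\Phi\,d\mu_g=u_b\Phi(b)-u_a\Phi(a).\qquad( * )$$ $\mathcal D(\mathcal A_{g,p})$ is the set of $([u],u_a,u_b)\in X_g^p$ for which there exists $v\in L_g^p([a,b))$ satisfying $( * )$; such $v$ is unique in $L_g^p$, and $\mathcal A_{g,p}([u],u_a,u_b):=v$. *)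

(* Defs.v *)
From HB Require Import structures.
From mathcomp Require Import all_boot all_order all_algebra.
From mathcomp Require Import ring lra complex.
From mathcomp Require Import all_classical all_reals all_analysis.
From mathcomp Require Import measurable_realfun ess_sup_inf.
Set Implicit Arguments.
Unset Strict Implicit.
Unset Printing Implicit Defensive.
Import Order.TTheory GRing.Theory Num.Theory.
Import numFieldNormedType.Exports.
Local Open Scope classical_set_scope.
Local Open Scope ring_scope.

Variant scalar_kind := RealScalars | ComplexScalars.

Definition scalar_field (R : realType) (k : scalar_kind) : numFieldType :=
  match k with
  | RealScalars => R : numFieldType
  | ComplexScalars => complex.complex R : numFieldType
  end.

Definition scalar_Re (R : realType) (k : scalar_kind) : scalar_field R k -> R :=
  match k with
  | RealScalars => fun x : R => x
  | ComplexScalars => fun z : complex.complex R => complex.Re z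
  end.

Definition scalar_Im (R : realType) (k : scalar_kind) : scalar_field R k -> R :=
  match k with
  | RealScalars => fun _ : R => 0
  | ComplexScalars => fun z : complex.complex R => complex.Im z
  end.

Definition scalar_of (R : realType) (k : scalar_kind) : R -> R -> scalar_field R k :=
  match k with
  | RealScalars => fun x _ => x
  | ComplexScalars => fun x y => complex.Complex x y
  end.

(* The norm of a numFieldType takes its values in the field itself; for C this
   is a complex number with zero imaginary part. *)
Definition scalar_abs (R : realType) (k : scalar_kind) (z : scalar_field R k) : R :=
  scalar_Re `|z|.

Section scalar_theory.
Context {R : realType} {k : scalar_kind}.
Implicit Types x y : scalar_field R k.

Lemma scalar_ReD x y : scalar_Re (x + y) = scalar_Re x + scalar_Re y.
Proof. by case: k x y => // -[a b] [c d]. Qed.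

Lemma scalar_ImD x y : scalar_Im (x + y) = scalar_Im x + scalar_Im y.
Proof. by case: k x y => [x y|[a b] [c d]] //=; rewrite addr0. Qed.

Lemma scalar_ReM x y :
  scalar_Re (x * y) = scalar_Re x * scalar_Re y - scalar_Im x * scalar_Im y.
Proof. by case: k x y => [x y|[a b] [c d]] //=; rewrite mulr0 subr0. Qed.

Lemma scalar_ImM x y :
  scalar_Im (x * y) = scalar_Re x * scalar_Im y + scalar_Im x * scalar_Re y.
Proof. by case: k x y => [x y|[a b] [c d]] //=; rewrite mulr0 mul0r addr0. Qed.

Lemma scalar_Re0 : scalar_Re (0 : scalar_field R k) = 0.
Proof. by case: k. Qed.

Lemma scalar_Im0 : scalar_Im (0 : scalar_field R k) = 0.
Proof. by case: k. Qed.

Lemma scalar_absE x :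
  scalar_abs x = Num.sqrt (scalar_Re x ^+ 2 + scalar_Im x ^+ 2).
Proof.
by case: k x => [x|[a b]] //=; rewrite expr0n addr0 sqrtr_sqr.
Qed.

Lemma scalar_abs_ge0 x : 0 <= scalar_abs x.
Proof. by rewrite scalar_absE sqrtr_ge0. Qed.

Lemma scalar_absD x y : scalar_abs (x + y) <= scalar_abs x + scalar_abs y.
Proof.
rewrite /scalar_abs -scalar_ReD; have := ler_normD x y.
by case: k x y => [//|x y]; rewrite complex.lecE => /andP[].
Qed.

Lemma scalar_absM x y : scalar_abs (x * y) = scalar_abs x * scalar_abs y.
Proof.
rewrite !scalar_absE -sqrtrM ?addr_ge0 ?sqr_ge0// scalar_ReM scalar_ImM.
congr Num.sqrt.
rewrite !sqrrD !sqrrN !exprMn; set a := scalar_Re x; set b := scalar_Im x.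
by rewrite mulrDl !mulrDr; ring.
Qed.

Lemma scalar_abs0 : scalar_abs (0 : scalar_field R k) = 0.
Proof. by rewrite scalar_absE scalar_Re0 scalar_Im0 expr0n addr0 sqrtr0. Qed.

End scalar_theory.

Section scalar_Lp.
Context {d} {T : measurableType d} {R : realType} (k : scalar_kind).
Variable mu : {measure set T -> \bar R}.
Local Notation F := (scalar_field R k).
Implicit Types (f : T -> F) (p : \bar R).

Definition scalar_measurable f :=
  measurable_fun [set: T] (@scalar_Re R k \o f) /\
  measurable_fun [set: T] (@scalar_Im R k \o f).

Definition scalar_integral (D : set T) f : F :=
  scalar_of k (\int[mu]_(x in D) scalar_Re (f x))
              (\int[mu]_(x in D) scalar_Im (f x)).

Definition in_Lp p f : Prop :=
  scalar_measurable f /\ finite_norm mu p (@scalar_abs R k \o f).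

Lemma scalar_abs_measurable f : scalar_measurable f ->
  measurable_fun [set: T] (@scalar_abs R k \o f).
Proof.
move=> [mRe mIm].
rewrite (_ : _ \o _ = fun x =>
    Num.sqrt ((scalar_Re (f x)) ^+ 2 + (scalar_Im (f x)) ^+ 2)); last first.
  by apply/funext => x /=; rewrite scalar_absE.
apply: (@measurableT_comp _ _ _ _ _ _ (@Num.sqrt R)) => //.
  by apply: continuous_measurable_fun; exact: sqrt_continuous.
by apply: measurable_funD; exact: measurable_funX.
Qed.

Lemma scalar_measurableZD (c : F) f g :
  scalar_measurable f -> scalar_measurable g -> scalar_measurable (c *: f + g).
Proof.
move=> [mf1 mf2] [mg1 mg2]; split.
  rewrite (_ : _ \o _ = fun x => scalar_Re c * scalar_Re (f x)
      - scalar_Im c * scalar_Im (f x) + scalar_Re (g x)); last first.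
    by apply/funext => x /=; rewrite scalar_ReD scalar_ReM.
  by apply: measurable_funD => //; apply: measurable_funB; exact: measurable_funM.
rewrite (_ : _ \o _ = fun x => scalar_Re c * scalar_Im (f x)
    + scalar_Im c * scalar_Re (f x) + scalar_Im (g x)); last first.
  by apply/funext => x /=; rewrite scalar_ImD scalar_ImM.
by apply: measurable_funD => //; apply: measurable_funD; exact: measurable_funM.
Qed.

Lemma finite_norm_le p (f g : T -> R) : (1 <= p)%E ->
  measurable_fun [set: T] f -> measurable_fun [set: T] g ->
  (forall x, `|f x| <= `|g x|) -> finite_norm mu p g -> finite_norm mu p f.
Proof.
move=> p1 mf mg fg; apply: le_lt_trans; rewrite unlock /Lnorm.
case: p p1 => [r|_|//].
- rewrite lee_fin => r1; have r0 : 0 <= r by rewrite (le_trans _ r1).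
  apply: gt0_ler_poweR; rewrite ?invr_ge0//.
  + by rewrite in_itv/= leey andbT integral_ge0.
  + by rewrite in_itv/= leey andbT integral_ge0.
  apply: ge0_le_integral => //=.
  + apply/measurable_EFinP.
    apply: (@measurableT_comp _ _ _ _ _ _ (@powR R ^~ r)) => //.
    exact: measurableT_comp.
  + apply/measurable_EFinP.
    apply: (@measurableT_comp _ _ _ _ _ _ (@powR R ^~ r)) => //.
    exact: measurableT_comp.
  + by move=> x _; rewrite lee_fin ge0_ler_powR// nnegrE.
- case: ifPn => // _; apply: le_ess_sup; apply: aeW => x /=.
  by rewrite lee_fin.
Qed.

Lemma in_LpZD p (c : F) f g : (1 <= p)%E ->
  in_Lp p f -> in_Lp p g -> in_Lp p (c *: f + g).
Proof.
move=> p1 [mf ff] [mg fg].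
have maf := scalar_abs_measurable mf; have mag := scalar_abs_measurable mg.
split; first exact: scalar_measurableZD.
pose af : T -> R := @scalar_abs R k \o f; pose ag : T -> R := @scalar_abs R k \o g.
have Lf : af \in Lfun mu p.
  by rewrite inE; apply/andP; split; rewrite inE.
have Lg : ag \in Lfun mu p.
  by rewrite inE; apply/andP; split; rewrite inE.
have := (Lfun_submod_closed mu p1).2 (scalar_abs c) _ _ Lf Lg.
rewrite inE => /andP[/[!inE]/= mh fh].
apply: finite_norm_le fh => //.
  exact/scalar_abs_measurable/scalar_measurableZD.
move=> x; rewrite !ger0_norm ?scalar_abs_ge0//=; last first.
  by rewrite addr_ge0 ?mulr_ge0 ?scalar_abs_ge0.
by rewrite (le_trans (scalar_absD _ _))// scalar_absM.
Qed.

Lemma in_Lp0 p : (1 <= p)%E -> in_Lp p (0 : T -> F).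
Proof.
move=> p1; split.
  split.
    rewrite (_ : _ \o _ = cst 0) //.
    by apply/funext => x /=; rewrite scalar_Re0.
  rewrite (_ : _ \o _ = cst 0) //.
  by apply/funext => x /=; rewrite scalar_Im0.
rewrite (_ : _ \o _ = cst 0); first exact: finite_norm_cst0.
by apply/funext => x /=; rewrite scalar_abs0.
Qed.

End scalar_Lp.

Section Lp_space.
Context {d} {T : measurableType d} {R : realType} (k : scalar_kind).
Variables (mu : {measure set T -> \bar R}) (p : \bar R) (p1 : (1 <= p)%E).
Local Notation F := (scalar_field R k).

Definition Lp_pred (_ : (1 <= p)%E) : {pred T -> F} :=
  [pred f | `[< in_Lp mu p f >]].

Lemma Lp_pred_submod_closed : submod_closed (Lp_pred p1).
Proof.
split=> [|c f g]; first exact/asboolP/in_Lp0.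
by move=> /asboolP Lf /asboolP Lg; exact/asboolP/in_LpZD.
Qed.

HB.instance Definition _ :=
  GRing.isSubmodClosed.Build F (T -> F) (Lp_pred p1) Lp_pred_submod_closed.

Record Lp_fun := LpFun { Lp_val :> T -> F; _ : Lp_val \in Lp_pred p1 }.

HB.instance Definition _ := [isSub for Lp_val].
HB.instance Definition _ := [Choice of Lp_fun by <:].
HB.instance Definition _ := [SubChoice_isSubLmodule of Lp_fun by <:].

Definition Lp_null : {pred Lp_fun} :=
  [pred f : Lp_fun | `[< (f : T -> F) = cst 0 %[ae mu] >]].

Lemma Lp_null_submod_closed : submod_closed Lp_null.
Proof.
split=> [|c f g]; first exact/asboolP/aeW.
move=> /asboolP f0 /asboolP g0; apply/asboolP.
apply: filterS2 f0 g0 => x /(_ I) fx /(_ I) gx _.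
by rewrite /= [LHS](_ : _ = c * f x + g x)// fx gx mulr0 addr0.
Qed.

HB.instance Definition _ :=
  GRing.isSubmodClosed.Build F Lp_fun Lp_null Lp_null_submod_closed.

Definition Lp_space : Type := Quotient.quot Lp_null.
HB.instance Definition _ := GRing.Zmodule.on Lp_space.
HB.instance Definition _ := EqQuotient.on Lp_space.

Definition Lp_repr (u : Lp_space) : T -> F := Lp_val (repr u).

Definition Lp_norm (u : Lp_space) : R :=
  fine 'N[mu]_p[EFin \o (@scalar_abs R k \o Lp_repr u)].

Local Open Scope quotient_scope.

Definition Lp_class (f : Lp_fun) : Lp_space := \pi_(Quotient.quot Lp_null) f.

Lemma Lp_classP (f g : Lp_fun) :
  Lp_class f = Lp_class g <-> (f : T -> F) = g %[ae mu].
Proof.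
rewrite /Lp_class; split=> [/eqP|fg].
  rewrite -Quotient.idealrBE => /asboolP; apply: filterS => x /(_ I) h _.
  by apply/eqP; rewrite -subr_eq0; apply/eqP; exact: h.
apply/eqP; rewrite -Quotient.idealrBE; apply/asboolP.
apply: filterS fg => x /(_ I) h _.
by rewrite [LHS](_ : _ = f x - g x)// h subrr.
Qed.

Lemma Lp_reprK (u : Lp_space) : Lp_class (repr u) = u.
Proof. exact: reprK. Qed.

Definition Lp_scale (c : F) (u : Lp_space) : Lp_space := Lp_class (c *: repr u).

Lemma Lp_class_is_zmod_morphism : zmod_morphism Lp_class.
Proof. exact: raddfB. Qed.
HB.instance Definition _ :=
  GRing.isZmodMorphism.Build Lp_fun Lp_space Lp_class Lp_class_is_zmod_morphism.

Lemma Lp_class_scale c f : Lp_class (c *: f) = Lp_scale c (Lp_class f).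
Proof.
apply/Lp_classP; have : (repr (Lp_class f) : T -> F) = f %[ae mu].
  by apply/Lp_classP; rewrite Lp_reprK.
apply: filterS => x /(_ I) h _.
by rewrite [LHS](_ : _ = c * f x)// -h.
Qed.

Lemma Lp_scaleA a b u : Lp_scale a (Lp_scale b u) = Lp_scale (a * b) u.
Proof. by rewrite -(Lp_reprK u) -!Lp_class_scale scalerA. Qed.

Lemma Lp_scale1 : left_id 1 Lp_scale.
Proof. by move=> u; rewrite -(Lp_reprK u) -Lp_class_scale scale1r. Qed.

Lemma Lp_scaleDr : right_distributive Lp_scale +%R.
Proof.
move=> a u v; rewrite -(Lp_reprK u) -(Lp_reprK v) -raddfD -!Lp_class_scale.
by rewrite -raddfD scalerDr.
Qed.

Lemma Lp_scaleDl u : {morph Lp_scale^~ u : a b / a + b}.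
Proof.
move=> a b /=; rewrite -(Lp_reprK u) -!Lp_class_scale -raddfD.
by rewrite scalerDl.
Qed.

HB.instance Definition _ := GRing.Zmodule_isLmodule.Build F Lp_space
  Lp_scaleA Lp_scale1 Lp_scaleDr Lp_scaleDl.

End Lp_space.

(* [g : [a, b] -> R] is represented by a function on R; every definition below
   depends only on its values on [a, b]. *)
Record integrator (R : realType) (a b : R) := Integrator {
  integrator_fun :> R -> R ;
  integrator_nondecreasing :
    {in `[a, b] &, {homo integrator_fun : x y / x <= y}} ;
  integrator_left_continuous : forall t, t \in `]a, b] ->
    integrator_fun x @[x --> t^'-] --> integrator_fun t }.

Section stieltjes.
Context {R : realType} {a b : R}.
Variable g : integrator a b.

Definition clamp (a b x : R) : R := Num.max a (Num.min x b).

(* The library's Lebesgue-Stieltjes measure is built from right-continuous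
   functions and intervals ]s, t]. We extend [g] by constants to R, reflect it
   through the origin, and push the resulting measure forward along [-%R]. *)
Definition reflected_integrator (x : R) : R := - g (clamp a b (- x)).

Lemma reflected_integrator_nondecreasing :
  {homo reflected_integrator : x y / x <= y}.
Proof.
move=> x y xy; rewrite /reflected_integrator lerN2.
have [ba|ab] := ltP b a.
  by rewrite /clamp !max_l// ge_min (ltW ba) orbT.
have clampP z : clamp a b z \in `[a, b].
  by rewrite in_itv/= /clamp le_max lexx/= ge_max ab ge_min lexx orbT.
apply: integrator_nondecreasing => //.
by rewrite /clamp le_max2// le_min2// lerN2.
Qed.

Lemma reflected_integrator_right_continuous :
  right_continuous reflected_integrator.
Proof.
move=> x; rewrite /reflected_integrator; apply: cvgN.
apply/cvg_at_rightNP.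
have -> : (fun y : R => g (clamp a b (- y))) \o -%R = g \o clamp a b.
  by apply/funext => y /=; rewrite opprK.
move: (- x) => t {x}.
have gt_cst : (fun=> g (clamp a b t)) z @[z --> t^'-] --> g (clamp a b t).
  exact: cvg_cst.
have [ba|ab] := ltP b a.
  have cE z : clamp a b z = a by rewrite /clamp max_l// ge_min (ltW ba) orbT.
  rewrite cE (_ : g \o _ = cst (g a)); first exact: cvg_cst.
  by apply/funext => z /=; rewrite cE.
have [ta|lat] := leP t a.
  apply: cvg_trans gt_cst.
  apply: (@near_eq_cvg _ _ t^'-); near=> s => /=.
  have st : s < t by near: s; exact: nbhs_left_lt.
  have sa : s <= a := le_trans (ltW st) ta.
  by rewrite /clamp !max_l// ge_min ?ta ?sa.
have [tb|bt] := leP t b.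
  have -> : clamp a b t = t by rewrite /clamp (min_l tb) (max_r (ltW lat)).
  have glt : g x @[x --> t^'-] --> g t.
    by apply: integrator_left_continuous; rewrite in_itv/= lat.
  apply: cvg_trans glt; apply: (@near_eq_cvg _ _ t^'-); near=> s => /=.
  have st : s < t by near: s; exact: nbhs_left_lt.
  have sa : a < s by near: s; exact: nbhs_left_gt.
  have sb : s <= b := ltW (lt_le_trans st tb).
  by rewrite /clamp (min_l sb) (max_r (ltW sa)).
apply: cvg_trans gt_cst.
apply: (@near_eq_cvg _ _ t^'-); near=> s => /=.
have sb : b < s by near: s; exact: nbhs_left_gt.
by rewrite /clamp (min_r (ltW sb)) (min_r (ltW bt)).
Unshelve. all: by end_near. Qed.

HB.instance Definition _ := isCumulative.Build R _ R reflected_integrator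
  reflected_integrator_nondecreasing reflected_integrator_right_continuous.

Definition stieltjes_borel_measure : set (measurableTypeR R) -> \bar R :=
  pushforward (lebesgue_stieltjes_measure reflected_integrator)
    (-%R : measurableTypeR R -> measurableTypeR R).

Let measurable_oppR :
  measurable_fun [set: measurableTypeR R] (-%R : _ -> measurableTypeR R).
Proof. exact: oppr_measurable. Qed.

Let stieltjes_borel0 : stieltjes_borel_measure set0 = 0%E.
Proof. by rewrite /stieltjes_borel_measure /pushforward preimage_set0 measure0. Qed.

Let stieltjes_borel_ge0 A : (0 <= stieltjes_borel_measure A)%E.
Proof. exact: measure_ge0. Qed.

Let stieltjes_borel_sigma_additive : semi_sigma_additive stieltjes_borel_measure.
Proof.
move=> F mF tF mUF; rewrite /stieltjes_borel_measure /pushforward preimage_bigcup.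
apply: measure_semi_sigma_additive.
- by move=> n; rewrite -[X in measurable X]setTI; exact: measurable_oppR.
- apply/trivIsetP => /= i j _ _ ij; rewrite -preimage_setI.
  by move/trivIsetP : tF => /(_ _ _ _ _ ij) ->//; rewrite preimage_set0.
- by rewrite -preimage_bigcup -[X in measurable X]setTI; exact: measurable_oppR.
Qed.

HB.instance Definition _ := isMeasure.Build _ _ _ stieltjes_borel_measure
  stieltjes_borel0 stieltjes_borel_ge0 stieltjes_borel_sigma_additive.

(* R with the completed sigma-algebra. The complement of [a, b[ is a null set,
   so functions on this space up to a.e. equality are functions on [a, b[ up to
   a.e. equality. *)
Definition stieltjes_space : measurableType _ :=
  caratheodory_type (mu_ext stieltjes_borel_measure).

Definition stieltjes_measure : {measure set stieltjes_space -> \bar R} :=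
  @completed_measure_extension _ _ _ stieltjes_borel_measure.

Let stieltjes_measureE s t : s <= t ->
  stieltjes_measure `[s, t[%classic = (g (clamp a b t) - g (clamp a b s))%:E.
Proof.
move=> st.
have ocE : [set` `]- t, - s]] = -%R @^-1` `[s, t[ :> set R.
  by apply/seteqP; split=> x /=; rewrite !in_itv/= lerNr ltrNl andbC.
rewrite /stieltjes_measure /= /completed_measure_extension.
rewrite measurable_mu_extE/=; last exact: measurable_itv.
rewrite /stieltjes_borel_measure /pushforward -ocE.
rewrite /lebesgue_stieltjes_measure /measure_extension measurable_mu_extE/=; last first.
  exact: is_ocitv.
by rewrite wlength_itv_bnd ?lerN2// /reflected_integrator !opprK addrC.
Qed.

Lemma stieltjes_measure_itv s t : a <= s -> s <= t -> t <= b ->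
  stieltjes_measure `[s, t[%classic = (g t - g s)%:E.
Proof.
move=> las st tb; rewrite stieltjes_measureE//.
have clampE z : a <= z -> z <= b -> clamp a b z = z.
  by move=> az zb; rewrite /clamp min_l// max_r.
by rewrite !clampE ?(le_trans las)// ?(le_trans st).
Qed.

Lemma stieltjes_measure_setT : a <= b ->
  stieltjes_measure [set: R] = (g b - g a)%:E.
Proof.
move=> ab; pose I (n : nat) : set R := `[a - n%:R, b + n%:R[%classic.
have mI n : measurable (I n : set stieltjes_space).
  by apply: sub_caratheodory; apply: sub_sigma_algebra; exact: measurable_itv.
have muI n : stieltjes_measure (I n) = (g b - g a)%:E.
  rewrite stieltjes_measureE; last first.
    by rewrite (@le_trans _ _ a) ?gerBl// (le_trans ab)// lerDl.
  have -> : clamp a b (b + n%:R) = b by rewrite /clamp min_r ?lerDl// max_r.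
  by rewrite [X in _ - g X](_ : _ = a)// /clamp max_l// ge_min gerBl ler0n.
have UI : \bigcup_n I n = [set: R].
  rewrite -subTset => x _; exists (Num.bound (`|x| + `|a| + `|b|)) => //=.
  have := archi_boundP (addr_ge0 (addr_ge0 (normr_ge0 x) (normr_ge0 a)) (normr_ge0 b)).
  rewrite /I/= in_itv/=; set N := _%:R => xN.
  have := ler_norm x; have := ler_norm (- x); rewrite normrN.
  have := ler_norm a; have := ler_norm (- b); rewrite normrN.
  have := normr_ge0 a; have := normr_ge0 b.
  by move=> *; apply/andP; split; lra.
rewrite -UI; have := @nondecreasing_cvg_mu _ _ _ stieltjes_measure I mI.
move=> /(_ (bigcup_measurable (fun n _ => mI n))) muUI.
have ndI : nondecreasing_seq I.
  move=> m n mn; apply/subsetPset => x; rewrite /I /= !in_itv/= => /andP[mx xm].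
  have : m%:R <= n%:R :> R by rewrite ler_nat.
  by move=> *; apply/andP; split; lra.
have {muUI ndI} := cvg_lim (@ereal_hausdorff R) (muUI ndI).
rewrite (_ : _ \o _ = cst (g b - g a)%:E); last exact/funext.
by rewrite lim_cst => [<-|]//; exact: ereal_hausdorff.
Qed.

End stieltjes.

Section sobolev.
Context {R : realType} (k : scalar_kind) {a b : R}.
Variable g : integrator a b.
Local Notation F := (scalar_field R k).
Local Notation mu := (stieltjes_measure g).
Implicit Types (U v : R -> F) (p : \bar R).

Definition abs_continuous_wrt U : Prop :=
  forall eps : R, 0 < eps -> exists2 delta : R, 0 < delta &
  forall (n : nat) (s t : 'I_n -> R),
    (forall j, [/\ a <= s j, s j < t j & t j <= b]) ->
    trivIset [set: 'I_n] (fun j => `[s j, t j[%classic) ->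
    \sum_(j < n) (g (t j) - g (s j)) < delta ->
    \sum_(j < n) scalar_abs (U (t j) - U (s j)) < eps.

(* [v] is a representative of the Stieltjes derivative of [U], which is only
   determined almost everywhere. *)
Definition is_stieltjes_derivative U v : Prop :=
  in_Lp mu 1 v /\
  forall t, t \in `[a, b] -> U t = U a + scalar_integral mu (`[a, t[%classic) v.

Definition sobolev p U : Prop :=
  [/\ abs_continuous_wrt U, in_Lp mu p U &
      exists2 v, is_stieltjes_derivative U v & in_Lp mu p v].

Definition jump (t : R) : R := lim (g x @[x --> t^'+]) - g t.

Definition jump_points : set R := [set t | (t \in `[a, b[) /\ (0 < jump t)].

Definition posterior_trace U (t : R) : F :=
  if t \in jump_points then lim (U x @[x --> t^'+]) else U t.

End sobolev.

Section state_operator.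
Context {R : realType} (k : scalar_kind) {a b : R}.
Variables (g : integrator a b) (p : \bar R) (p1 : (1 <= p)%E).
Local Notation F := (scalar_field R k).
Local Notation mu := (stieltjes_measure g).
Local Notation Lpg := (Lp_space k mu p1).

(* The state ([u], u_a, u_b) is [(u, (ua, ub))]. *)
Definition state_space : lmodType F := (Lpg * (F^o * F^o))%type.

Definition state_norm (x : state_space) : R :=
  Lp_norm x.1 + scalar_abs (x.2.1 : F) + scalar_abs (x.2.2 : F).

Definition weak_identity (x : state_space) (v : Lpg) : Prop :=
  forall Phi DPhi : R -> F,
    sobolev g (hoelder_conjugate p) Phi -> is_stieltjes_derivative g Phi DPhi ->
    scalar_integral mu (`[a, b[%classic) (fun t => Lp_repr x.1 t * DPhi t)
    + scalar_integral mu (`[a, b[%classic)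
        (fun t => Lp_repr v t * posterior_trace g Phi t)
    = x.2.2 * Phi b - x.2.1 * Phi a.

Definition state_domain : set state_space :=
  [set x | exists v : Lpg, weak_identity x v].

(* The [v] of the weak identity is unique; off [state_domain] the value is 0. *)
Definition state_operator (x : state_space) : Lpg := xget 0 (weak_identity x).

End state_operator.
Arguments state_norm {R} k {a b} g {p} p1 x.
Arguments weak_identity {R} k {a b} g {p} p1 x v.
Arguments state_domain {R} k {a b} g {p} p1.
Arguments state_operator {R} k {a b} g {p} p1 x.

Definition linear_operator (K : pzRingType) (X Y : lmodType K)
    (D : set X) (A : X -> Y) : Prop :=
  D 0 /\ forall (c : K) (x y : X), D x -> D y ->
    D (c *: x + y) /\ A (c *: x + y) = c *: A x + A y.

(* Sequential closedness of the graph for the norms [nX] and [nY]. *)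
Definition closed_operator (R : realType) (X Y : zmodType)
    (nX : X -> R) (nY : Y -> R) (D : set X) (A : X -> Y) : Prop :=
  forall (x_ : nat -> X) (x : X) (y : Y), (forall n, D (x_ n)) ->
    nX (x_ n - x) @[n --> \oo] --> 0 ->
    nY (A (x_ n) - y) @[n --> \oo] --> 0 ->
    D x /\ A x = y.

(* Main.v *)
Require Import Defs.
From HB Require Import structures.
From mathcomp Require Import all_boot all_order all_algebra.
From mathcomp Require Import ring lra complex.
From mathcomp Require Import all_classical all_reals all_analysis.
From mathcomp Require Import measurable_realfun ess_sup_inf.
Set Implicit Arguments.
Unset Strict Implicit.
Unset Printing Implicit Defensive.
Import Order.TTheory GRing.Theory Num.Theory.
Import numFieldNormedType.Exports.
Local Open Scope classical_set_scope.
Local Open Scope ring_scope.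

(**
Write [primitive c v t = c + \int_[a,t[ v dmu]. A state [(u, u_a, u_b)] satisfies
the weak identity with [v] iff [u = primitive u_a v] almost everywhere and
[u_b = primitive u_a v b]; linearity, the domain and the kernel are read off this.

If: Fubini on the triangle [s < t] and its complement [t <= s] gives the
integration by parts formula. The asymmetry between [<] and [<=] at an atom is
what the posterior trace accounts for, since
[S Phi t = Phi a + \int_[a,t] D Phi].

Only if: subtracting the formula for [primitive u_a v] leaves
[\int (u - primitive u_a v) phi = (u_b - primitive u_a v b) * Phi b] for every bounded
[phi]; test with the constant 1, then with the primitives of indicators.

Uniqueness of [v]: a primitive vanishing almost everywhere and at [b] vanishes
everywhere, so its density integrates to 0 over intervals, hence over Borel sets,
hence over the completed sigma-algebra.

Closedness: [(u - primitive u_a v, u_b - primitive u_a v b)] is linear in the state and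
[v], vanishes on the graph, and is bounded in L^1 by their norms (Hoelder).
*)

(** * Real and imaginary parts of scalars, uniformly over R and C *)

Section scalar_components.
Context {R : realType} {k : scalar_kind}.
Local Notation F := (scalar_field R k).
Implicit Types x y z e : F.

Lemma scalar_eq x y :
  scalar_Re x = scalar_Re y -> scalar_Im x = scalar_Im y -> x = y.
Proof. by case: k x y => [x y|[? ?] [? ?]] //= -> ->. Qed.

Lemma scalar_ReN x : scalar_Re (- x) = - scalar_Re x.
Proof. by case: k x => [x|[? ?]]. Qed.

Lemma scalar_ImN x : scalar_Im (- x) = - scalar_Im x.
Proof. by case: k x => [x|[? ?]] //=; rewrite oppr0. Qed.

Lemma scalar_ReB x y : scalar_Re (x - y) = scalar_Re x - scalar_Re y.
Proof. by rewrite scalar_ReD scalar_ReN. Qed.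

Lemma scalar_ImB x y : scalar_Im (x - y) = scalar_Im x - scalar_Im y.
Proof. by rewrite scalar_ImD scalar_ImN. Qed.

Lemma scalar_Re_of (r s : R) : scalar_Re (scalar_of k r s) = r.
Proof. by case: k. Qed.

Lemma scalar_Im_of0 (r : R) : scalar_Im (scalar_of k r 0) = 0.
Proof. by case: k. Qed.

Lemma normr_scalar_Re x : `|scalar_Re x| <= scalar_abs x.
Proof. by rewrite scalar_absE -sqrtr_sqr ler_wsqrtr// lerDl sqr_ge0. Qed.

Lemma normr_scalar_Im x : `|scalar_Im x| <= scalar_abs x.
Proof. by rewrite scalar_absE -sqrtr_sqr ler_wsqrtr// lerDr sqr_ge0. Qed.

Lemma scalar_abs_le x : scalar_abs x <= `|scalar_Re x| + `|scalar_Im x|.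
Proof.
rewrite scalar_absE -[leRHS]ger0_norm ?addr_ge0// -sqrtr_sqr ler_wsqrtr//.
by rewrite sqrrD !real_normK ?num_real// addrAC lerDl mulrn_wge0// mulr_ge0.
Qed.

Lemma scalar_absN x : scalar_abs (- x) = scalar_abs x.
Proof. by rewrite /scalar_abs normrN. Qed.

Lemma scalar_abs_le0 x : scalar_abs x <= 0 -> x = 0.
Proof.
move=> x0; apply: scalar_eq; apply/eqP; rewrite ?scalar_Re0 ?scalar_Im0 -normr_le0.
  exact: le_trans (normr_scalar_Re x) x0.
exact: le_trans (normr_scalar_Im x) x0.
Qed.

Lemma scalar_Re_gt0 e : 0 < e -> 0 < scalar_Re e.
Proof. by case: k e => [//|[e1 e2]]; rewrite complex.ltcE => /andP[]. Qed.

(** In C both the norm and the order live in the field itself, and [0 < e] forces [e] to be real.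
    Real estimates thus transfer to the limits taken in the scalar field. *)
Lemma normr_lt_scalar x e : 0 < e -> scalar_abs x < scalar_Re e -> `|x| < e.
Proof.
rewrite /scalar_abs; case: k x e => [//|[x1 x2] [e1 e2]].
rewrite !complex.ltcE/= => /andP[/eqP-> _] ->.
by rewrite eqxx.
Qed.

End scalar_components.

(** * Integrals of scalar functions, and L^p inclusions for a finite measure *)

Section scalar_integral_theory.
Context {d} {T : measurableType d} {R : realType} (k : scalar_kind).
Variable mu : {measure set T -> \bar R}.
Local Notation F := (scalar_field R k).
Implicit Types (f : T -> F) (D : set T).

Lemma scalar_Re_integral D f :
  scalar_Re (scalar_integral mu D f) = \int[mu]_(x in D) scalar_Re (f x).
Proof. by rewrite /scalar_integral scalar_Re_of. Qed.

Lemma scalar_Im_integral D f :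
  scalar_Im (scalar_integral mu D f) = \int[mu]_(x in D) scalar_Im (f x).
Proof.
rewrite /scalar_integral; case: k f => //= f.
by rewrite /Rintegral integral0.
Qed.

Lemma in_L1_abs f : in_Lp mu 1 f -> mu.-integrable setT (EFin \o (@scalar_abs R k \o f)).
Proof.
move=> [mf ff]; apply/Lfun1_integrable.
by rewrite inE; apply/andP; split; rewrite inE//=; exact: scalar_abs_measurable.
Qed.

Lemma in_L1_Re f : in_Lp mu 1 f ->
  mu.-integrable setT (EFin \o (fun x => scalar_Re (f x))).
Proof.
move=> /[dup] -[[mf _] _] /in_L1_abs; apply: le_integrable => //.
  exact/measurable_EFinP.
by move=> x _ /=; rewrite lee_fin [leRHS]ger0_norm ?scalar_abs_ge0// normr_scalar_Re.
Qed.

Lemma in_L1_Im f : in_Lp mu 1 f ->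
  mu.-integrable setT (EFin \o (fun x => scalar_Im (f x))).
Proof.
move=> /[dup] -[[_ mf] _] /in_L1_abs; apply: le_integrable => //.
  exact/measurable_EFinP.
by move=> x _ /=; rewrite lee_fin [leRHS]ger0_norm ?scalar_abs_ge0// normr_scalar_Im.
Qed.

(** Real and imaginary parts are each bounded by the integral of the modulus; adding the two bounds
    produces the factor 2. *)
Lemma scalar_integral_abs_le D f : measurable D -> in_Lp mu 1 f ->
  scalar_abs (scalar_integral mu D f) <= 2 * \int[mu]_(x in D) scalar_abs (f x).
Proof.
move=> mD Lf.
have iT := @integrableS _ _ _ mu _ _ _ measurableT mD (@subsetT _ D).
rewrite (le_trans (scalar_abs_le _))// scalar_Re_integral scalar_Im_integral.
rewrite mulrDl mul1r lerD//.
  rewrite (le_trans (le_normr_Rintegral _ _))//; first exact/iT/in_L1_Re.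
  apply: le_Rintegral => //; last by move=> x _; exact: normr_scalar_Re.
    exact/integrable_norm/iT/in_L1_Re.
  exact/iT/in_L1_abs.
rewrite (le_trans (le_normr_Rintegral _ _))//; first exact/iT/in_L1_Im.
apply: le_Rintegral => //; last by move=> x _; exact: normr_scalar_Im.
  exact/integrable_norm/iT/in_L1_Im.
exact/iT/in_L1_abs.
Qed.

Lemma scalar_integralZD D (c : F) f1 f2 : measurable D ->
  in_Lp mu 1 f1 -> in_Lp mu 1 f2 ->
  scalar_integral mu D (c *: f1 + f2) =
  c * scalar_integral mu D f1 + scalar_integral mu D f2.
Proof.
move=> mD L1 L2.
have iT := @integrableS _ _ _ mu _ _ _ measurableT mD (@subsetT _ D).
have [r1 i1 r2 i2] := And4 (iT _ (in_L1_Re L1)) (iT _ (in_L1_Im L1))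
  (iT _ (in_L1_Re L2)) (iT _ (in_L1_Im L2)).
have iZ := fun (r : R) h => @integrableZl _ _ _ mu D mD r (EFin \o h).
apply: scalar_eq.
  rewrite scalar_ReD scalar_ReM !scalar_Re_integral !scalar_Im_integral.
  rewrite -!RintegralZl// -RintegralB// ?iZ// -RintegralD//; last first.
    exact: (@integrableB _ _ _ mu D mD) (iZ _ _ r1) (iZ _ _ i1).
  by apply: eq_Rintegral => x _ /=; rewrite scalar_ReD scalar_ReM.
rewrite scalar_ImD scalar_ImM !scalar_Re_integral !scalar_Im_integral.
rewrite -!RintegralZl// -RintegralD// ?iZ// -RintegralD//; last first.
  exact: (@integrableD _ _ _ mu D mD) (iZ _ _ i1) (iZ _ _ r1).
by apply: eq_Rintegral => x _ /=; rewrite scalar_ImD scalar_ImM.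
Qed.

Lemma ae_eq_Rintegral D (f g : T -> R) : measurable D ->
  measurable_fun [set: T] f -> measurable_fun [set: T] g -> f = g %[ae mu] ->
  \int[mu]_(x in D) f x = \int[mu]_(x in D) g x.
Proof.
move=> mD mf mg fg; congr fine; apply: ae_eq_integral => //.
- exact/measurable_EFinP/measurable_funTS.
- exact/measurable_EFinP/measurable_funTS.
- by apply: filterS fg => x /(_ I) -> .
Qed.

Lemma ae_eq_scalar_integral D f g : measurable D ->
  scalar_measurable f -> scalar_measurable g -> f = g %[ae mu] ->
  scalar_integral mu D f = scalar_integral mu D g.
Proof.
move=> mD [f1 f2] [g1 g2] fg; congr scalar_of; apply: ae_eq_Rintegral => //.
  by apply: filterS fg => x /(_ I) -> .
by apply: filterS fg => x /(_ I) -> .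
Qed.

Lemma ae_eq_mulr f g (h : T -> F) : f = g %[ae mu] ->
  (fun x => f x * h x) = (fun x => g x * h x) %[ae mu].
Proof. by apply: filterS => x /(_ I) ->. Qed.

Lemma eq_scalar_integral D f g : {in D, f =1 g} ->
  scalar_integral mu D f = scalar_integral mu D g.
Proof. by move=> fg; congr scalar_of; apply: eq_Rintegral => x /fg ->. Qed.

Lemma L1_eq0 f : in_Lp mu 1 f -> \int[mu]_x scalar_abs (f x) <= 0 ->
  f = cst 0 %[ae mu].
Proof.
move=> /in_L1_abs intf f0.
have mf := measurable_int _ intf.
have : (\int[mu]_x `|(EFin \o (@scalar_abs R k \o f)) x| = 0)%E.
  rewrite -[LHS]fineK; last exact: integrable_fin_num (integrable_abse intf).
  congr EFin; apply/eqP; rewrite eq_le; apply/andP; split; last first.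
    by rewrite fine_ge0// integral_ge0.
  apply: le_trans f0; rewrite le_eqVlt; apply/orP; left; apply/eqP; congr fine.
  by apply: eq_integral => x _ /=; rewrite ger0_norm ?scalar_abs_ge0.
move=> /(ae_eq_integral_abs mu measurableT mf).1.
by apply: filterS => x /(_ I) [/= fx] _; apply: scalar_abs_le0; rewrite fx.
Qed.

Hypothesis mufin : (mu [set: T] < +oo)%E.

Lemma bounded_in_Lp p f (M : R) : (1 <= p)%E -> scalar_measurable f ->
  (forall x, scalar_abs (f x) <= M) -> in_Lp mu p f.
Proof.
move=> p1 mf fM; split => //.
have mfin : mu [set: T] \is a fin_num by rewrite ge0_fin_numE.
have M0 : 0 <= `|M| by [].
apply: (@finite_norm_le _ _ _ mu p _ (cst `|M|)) => //.
- exact: scalar_abs_measurable.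
- move=> x /=; rewrite normr_id ger0_norm ?scalar_abs_ge0//.
  exact: le_trans (fM x) (ler_norm _).
have : (cst `|M| : T -> R) \in Lfun mu p.
  apply: (@Lfun_subset _ _ _ mu p +oo%E) => //; rewrite ?leey//.
  rewrite inE; apply/andP; split; rewrite inE//= /finite_norm unlock /Lnorm.
  (* The norm at exponent infinity is defined by cases: its value is 0 when the whole space is null,
     which settles the other branch. *)
  case: ifPn => // mu0; apply: (@le_lt_trans _ _ `|M|%:E); last exact: ltry.
  by apply/ess_supP/aeW => x /=; rewrite normr_id.
by rewrite inE => /andP[_ /[!inE]].
Qed.

Lemma in_Lp_L1 p f : (1 <= p)%E -> in_Lp mu p f -> in_Lp mu 1 f.
Proof.
move=> p1 [mf ff]; split => //.
have mfin : mu [set: T] \is a fin_num by rewrite ge0_fin_numE.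
have : (@scalar_abs R k \o f : T -> R) \in Lfun mu p.
  by rewrite inE; apply/andP; split; rewrite inE//=; exact: scalar_abs_measurable.
move=> /(@Lfun_subset _ _ _ mu 1 p (lexx _) p1 mfin p1).
by rewrite inE => /andP[_ /[!inE]].
Qed.

(* Hoelder against the constant 1. *)
Lemma L1_le_Lnorm p : (1 <= p)%E -> exists2 C : R, 0 <= C &
  forall h : T -> R, measurable_fun [set: T] h -> finite_norm mu p h ->
  \int[mu]_x `|h x| <= C * fine 'N[mu]_p[EFin \o h].
Proof.
have mfin : mu [set: T] \is a fin_num by rewrite ge0_fin_numE.
case: p => [r|_|//].
- rewrite lee_fin => r1; have r0 : 0 < r by rewrite (lt_le_trans _ r1).
  (* At [r = 1] the conjugate exponent is infinite; the bound is then an equality with constant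
     1. *)
  have [r1E|rN1] := eqVneq r 1.
    exists 1 => // h mh fh; rewrite mul1r r1E Lnorm1.
    exact: lexx.
  have {rN1} r1' : 1 < r by rewrite lt_neqAle eq_sym rN1.
  (* [q] is the exponent conjugate to [r], and the constant is the [q]-norm of the function 1. *)
  pose q := (1 - r^-1)^-1.
  have q0 : 0 < q by rewrite invr_gt0 subr_gt0 invf_lt1.
  have N1fin : ('N[mu]_q%:E[EFin \o (cst 1%R : T -> R)] < +oo)%E.
    have := @Lnorm_cst1 _ T R mu q; rewrite [X in Lnorm _ _ X = _]/=.
    by rewrite /comp /= => ->; rewrite poweR_lty.
  have N1ge0 := Lnorm_ge0 mu q%:E (EFin \o (cst 1%R : T -> R)).
  exists (fine 'N[mu]_q%:E[EFin \o (cst 1%R : T -> R)]); first exact: fine_ge0.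
  move=> h mh fh.
  have hge0 := Lnorm_ge0 mu r%:E (EFin \o h).
  have hfin : ('N[mu]_r%:E[EFin \o h])%E \is a fin_num by rewrite ge0_fin_numE.
  have Nfin : ('N[mu]_q%:E[EFin \o (cst 1%R : T -> R)])%E \is a fin_num.
    by rewrite ge0_fin_numE.
  have := @hoelder _ _ _ mu h (cst 1) r q mh (@measurable_cst _ _ _ _ _ _) r0 q0.
  rewrite /q invrK addrC subrK => /(_ erefl).
  rewrite -/q Lnorm1 => le1.
  have {}le1 : (\int[mu]_x (`|h x|)%:E <=
      'N[mu]_q%:E[EFin \o (cst 1%R : T -> R)] * 'N[mu]_r%:E[EFin \o h])%E.
    rewrite muleC; apply: le_trans le1; apply: ge0_le_integral => //.
    - exact/measurable_EFinP/measurableT_comp.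
    - by apply/measurable_EFinP; apply: measurableT_comp => //; exact: measurable_funM.
    - by move=> x _ /=; rewrite mulr1.
  rewrite -fineM// fine_le// ?fin_numM// ge0_fin_numE; last exact: integral_ge0.
  by apply: le_lt_trans le1 _; rewrite -(fineK hfin) -(fineK Nfin) -EFinM ltry.
(* At exponent infinity the constant is the total mass; a null space, where the norm is 0 by
   convention, is treated apart. *)
- exists (fine (mu [set: T])); first exact: fine_ge0.
  move=> h mh fh; have := Lnorm_ge0 mu +oo%E (EFin \o h).
  move: fh; rewrite /finite_norm unlock /Lnorm.
  case: ifPn => [mu0|]; last first.
    rewrite -leNgt measure_le0 => /eqP mu0 _ _; rewrite mulr0.
    rewrite /Rintegral null_set_integral//.
    exact/measurable_EFinP/measurableT_comp.
  move=> fh h0.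
  have Nfin : ess_sup mu (abse \o (EFin \o h)) \is a fin_num.
    by rewrite ge0_fin_numE.
  have le1 : (\int[mu]_x (`|h x|)%:E <= mu [set: T] * ess_sup mu (abse \o (EFin \o h)))%E.
    rewrite muleC -integral_cst//; apply: ae_ge0_le_integral => //.
    + exact/measurable_EFinP/measurableT_comp.
    + by apply: filterS (ess_sup_ge mu (abse \o (EFin \o h))) => x.
  rewrite -fineM// fine_le// ?fin_numM//.
  rewrite ge0_fin_numE; last exact: integral_ge0.
  apply: le_lt_trans le1 _.
  by rewrite -(fineK mfin) -(fineK Nfin) -EFinM ltry.
Qed.

End scalar_integral_theory.

(** * Fubini for a product function cut along a measurable set *)

Section Rintegral_fubini.
Context d (T : measurableType d) (R : realType).
Variable mu : {finite_measure set T -> \bar R}.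

(** By Tonelli it suffices that the iterated integral of the absolute value is finite, and this is
    the product of the two L^1 norms. *)
Lemma integrable_prod (f h : T -> R) :
  mu.-integrable setT (EFin \o f) -> mu.-integrable setT (EFin \o h) ->
  (mu \x mu)%E.-integrable setT (fun z => (f z.1 * h z.2)%:E).
Proof.
move=> intf inth.
have /measurable_EFinP mf := measurable_int _ intf.
have /measurable_EFinP mh := measurable_int _ inth.
have mK : measurable_fun [set: T * T] (fun z => (f z.1 * h z.2)%:E).
  apply/measurable_EFinP; apply: measurable_funM.
    exact: measurableT_comp mf _.
  exact: measurableT_comp mh _.
apply/(integrable12ltyP _ _ mK).
have /integrableP[mnf nf] := integrable_norm intf.
have /integrableP[mnh nh] := integrable_norm inth.
have inh : (\int[mu]_y (`|h y|)%:E)%E \is a fin_num.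
  rewrite ge0_fin_numE; last exact: integral_ge0.
  by apply: le_lt_trans nh; apply: ge0_le_integral => //;
    [exact: measurableT_comp|move=> x _ /=; rewrite normr_id].
rewrite (eq_integral
  (fun x => (`|f x|)%:E * (fine (\int[mu]_y (`|h y|)%:E))%:E)%E); last first.
  move=> x _; rewrite fineK// -ge0_integralZl//.
  by apply: eq_integral => y _; rewrite /= normrM EFinM.
rewrite ge0_integralZr//; last by rewrite lee_fin fine_ge0// integral_ge0.
rewrite fineK// lte_mul_pinfty//; first exact: integral_ge0.
  rewrite ge0_fin_numE; last exact: integral_ge0.
  by apply: le_lt_trans nf; apply: ge0_le_integral => //;
    [exact: measurableT_comp|move=> x _ /=; rewrite normr_id].
by rewrite -ge0_fin_numE//; exact: integral_ge0.
Qed.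

Lemma integrable_mul_indic d' (T' : measurableType d')
    (nu : {measure set T' -> \bar R}) (f : T' -> R) (A : set T') :
  measurable A -> nu.-integrable setT (EFin \o f) ->
  nu.-integrable setT (fun x => (f x * \1_A x)%:E).
Proof.
move=> mA /[dup] intf /measurable_int/measurable_EFinP mf.
apply: le_integrable intf => //.
  by apply/measurable_EFinP; exact: measurable_funM.
move=> x _ /=; rewrite lee_fin normrM ler_piMr//.
by rewrite ger0_norm// indicE; case: (_ \in _).
Qed.

Variables (f h : T -> R) (E : set (T * T)).
Hypotheses (intf : mu.-integrable setT (EFin \o f))
  (inth : mu.-integrable setT (EFin \o h)) (mE : measurable E).

(** The function is a Fubini marginal of [f s * 1] restricted to [E]; the constant 1 is integrable
    because [mu] is finite. *)
Lemma measurable_Rintegral_section :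
  measurable_fun [set: T] (fun t => \int[mu]_s (f s * \1_E (s, t))).
Proof.
have int1 : mu.-integrable setT (EFin \o cst 1).
  exact: finite_measure_integrable_cst.
have intK := integrable_mul_indic mE (integrable_prod intf int1).
have := measurable_fubini_G intK.
move/(measurableT_comp (@fine_measurable R _ (measurableT))).
congr measurable_fun; apply/funext => t /=.
by congr fine; apply: eq_integral => s _; rewrite mulr1.
Qed.

Lemma measurable_section1 (A : set (T * T)) s : measurable A ->
  measurable [set t | A (s, t)].
Proof. by move=> mA; rewrite -[X in measurable X]setTI; exact: (pair1_measurable s). Qed.

Lemma measurable_section2 (A : set (T * T)) t : measurable A ->
  measurable [set s | A (s, t)].
Proof. by move=> mA; rewrite -[X in measurable X]setTI; exact: (pair2_measurable t). Qed.

(** The two iterated integrals are taken in opposite orders, but both are integrals over the product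
    measure, one restricted to [E] and the other to its complement; together they give the full
    product. *)
Lemma Rintegral_prod_split :
  \int[mu]_t ((\int[mu]_s (f s * \1_E (s, t))) * h t)
  + \int[mu]_s (f s * \int[mu]_t (h t * \1_(~` E) (s, t)))
  = (\int[mu]_s f s) * (\int[mu]_t h t).
Proof.
have intK := integrable_prod intf inth.
have intK1 := integrable_mul_indic mE intK.
have intK2 := integrable_mul_indic (measurableC mE) intK.
transitivity (fine (\int[(mu \x mu)%E]_z (f z.1 * h z.2 * \1_E z)%:E)
   + fine (\int[(mu \x mu)%E]_z (f z.1 * h z.2 * \1_(~` E) z)%:E)).
  congr (fine _ + fine _).
    rewrite -(integral21_prod_meas1 intK1); apply: eq_integral => t _.
    have intE : mu.-integrable setT (EFin \o (fun s => f s * \1_E (s, t))).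
      by have := integrable_mul_indic (measurable_section2 t mE) intf.
    rewrite -RintegralZr// /fubini_G fineK; last first.
      apply: integrable_fin_num => //.
      apply: eq_integrable (integrableZr _ (h t) intE) => //.
    by apply: eq_integral => s _; rewrite mulrAC.
  rewrite -(integral12_prod_meas1 intK2); apply: eq_integral => s _.
  have intE : mu.-integrable setT (EFin \o (fun t => h t * \1_(~` E) (s, t))).
    by have := integrable_mul_indic (measurable_section1 s (measurableC mE)) inth.
  rewrite -RintegralZl// /fubini_F fineK; last first.
    by apply: integrable_fin_num => //; apply: eq_integrable (integrableZl _ (f s) intE).
  by apply: eq_integral => t _; rewrite mulrA.
rewrite -fineD; [|exact: integrable_fin_num..].
rewrite -integralD//.
transitivity (fine (\int[(mu \x mu)%E]_z (f z.1 * h z.2)%:E)).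
  congr fine; apply: eq_integral => z _; rewrite -EFinD -mulrDr.
  by rewrite !indicE in_setC; case: (z \in E); rewrite ?addr0 ?add0r mulr1.
rewrite -(integral12_prod_meas1 intK) -RintegralZr//; congr fine.
apply: eq_integral => s _; rewrite -RintegralZl// /fubini_F fineK//.
by apply: integrable_fin_num => //; apply: eq_integrable (integrableZl _ (f s) inth).
Qed.

End Rintegral_fubini.

(** * The Stieltjes measure: real primitives, integration by parts, atoms and right limits *)

Section stieltjes_theory.
Context {R : realType} {a b : R} (g : integrator a b).
Local Notation T := (stieltjes_space g).
Local Notation mu := (stieltjes_measure g).
Local Notation I := (`[a, b[%classic : set R).
Implicit Types (f h : R -> R).

Lemma measurable_borel (A : set (measurableTypeR R)) :
  measurable A -> measurable (A : set T).
Proof. by move=> mA; apply: sub_caratheodory; exact: sub_sigma_algebra. Qed.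

Lemma measurable_stieltjes_itv (i : interval R) : measurable ([set` i] : set T).
Proof. by apply: measurable_borel; exact: measurable_itv. Qed.
#[local] Hint Resolve measurable_stieltjes_itv : core.

Lemma measurable_stieltjes_id : measurable_fun [set: T] (id : T -> R).
Proof. by move=> _ B mB; rewrite setTI; exact: measurable_borel. Qed.

(** This is the triangle along which Fubini is applied, the preimage of []0, +oo[] under the
    difference of the coordinates. *)
Lemma measurable_stieltjes_lt : measurable [set z : T * T | (z.1 : R) < z.2].
Proof.
have m1 : measurable_fun [set: T * T] (fun z => (z.1 : R)).
  exact: (measurableT_comp measurable_stieltjes_id).
have m2 : measurable_fun [set: T * T] (fun z => (z.2 : R)).
  exact: (measurableT_comp measurable_stieltjes_id).
have := measurable_funB m2 m1 measurableT (measurable_itv `]0, +oo[).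
rewrite setTI; congr measurable; apply/seteqP; split=> z /=.
  by rewrite in_itv/= andbT subr_gt0.
by rewrite in_itv/= andbT subr_gt0.
Qed.

Hypothesis ab : a <= b.

Lemma stieltjes_measure_lty : (mu [set: T] < +oo)%E.
Proof. by rewrite (stieltjes_measure_setT g ab) ltry. Qed.

Let stieltjes_fin_num : fin_num_fun mu.
Proof.
move=> A mA; rewrite ge0_fin_numE//; apply: le_lt_trans stieltjes_measure_lty.
by apply: le_measure; rewrite ?inE.
Qed.

(* The argument [a <= b] lets the finiteness instance below be inferred. *)
Definition finite_stieltjes_measure of a <= b : set T -> \bar R := mu.

Local Notation fmu := (finite_stieltjes_measure ab).

HB.instance Definition _ := isMeasure.Build _ T R fmu
  (measure0 mu) (measure_ge0 mu) (@measure_semi_sigma_additive _ T R mu).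

HB.instance Definition _ := Measure_isFinite.Build _ T R fmu stieltjes_fin_num.

Lemma stieltjes_integrable_cst (r : R) : mu.-integrable [set: T] (EFin \o cst r).
Proof. exact: (@finite_measure_integrable_cst _ T R fmu). Qed.

(** The line and [I] have the same finite mass [g b - g a]. Hence integrals over the line and over
    [I] may be exchanged. *)
Lemma stieltjes_setC_itv : mu (~` I) = 0%E.
Proof.
have mI : measurable (I : set T) by [].
have := stieltjes_measure_setT g ab.
rewrite -(setUv I) measureU//; [|exact: measurableC|exact: setICr].
rewrite [X in (X + _)%E](_ : _ = (g b - g a)%:E); last first.
  exact: stieltjes_measure_itv.
move=> /eqP; rewrite addeC eq_sym -sube_eq//; last by rewrite fin_num_adde_defl.
by rewrite -EFinB subrr => /eqP.
Qed.

Lemma stieltjes_integrableS f (D : set T) : measurable D ->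
  mu.-integrable [set: T] (EFin \o f) -> mu.-integrable D (EFin \o f).
Proof. by move=> mD; apply: integrableS. Qed.

Lemma Rintegral_stieltjesT f : mu.-integrable [set: T] (EFin \o f) ->
  \int[mu]_x f x = \int[mu]_(x in I) f x.
Proof.
move=> intf; have mI : measurable (I : set T) by [].
have mCI : measurable (~` I : set T) by exact: measurableC.
rewrite -(setUv I) Rintegral_setU ?setUv//; last by rewrite disj_set2E setICr.
rewrite [X in _ + X]/Rintegral null_set_integral ?addr0//.
  by have /measurable_int := stieltjes_integrableS mCI intf.
exact: stieltjes_setC_itv.
Qed.

Lemma Rintegral_itv_split f s t : a <= s -> s <= t ->
  mu.-integrable [set: T] (EFin \o f) ->
  \int[mu]_(x in `[a, t[) f x =
  \int[mu]_(x in `[a, s[) f x + \int[mu]_(x in `[s, t[) f x.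
Proof.
move=> las st intf.
rewrite (@itv_bndbnd_setU _ _ (BLeft a) (BLeft s) (BLeft t)) ?bnd_simp//.
rewrite Rintegral_setU//.
  by apply: stieltjes_integrableS => //; exact: measurableU.
apply/disj_setPS => x [] /=; rewrite !in_itv/= => /andP[_ xs] /andP[sx _].
by move: xs; rewrite ltNge sx.
Qed.

Lemma Rintegral_indic (nu : {measure set T -> \bar R}) f (D : set T) :
  \int[nu]_(x in D) f x = \int[nu]_x (f x * \1_D x).
Proof.
rewrite Rintegral_mkcond; apply: eq_Rintegral => x _.
by rewrite patchE indicE; case: ifPn; rewrite ?mulr1 ?mulr0.
Qed.

(** The primitive integrates [f] over the sections of a planar set, so Fubini gives measurability.
    The flag [t0] selects [[a, t[] when true and [[a, t]] when false; integration by parts uses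
    both. *)
Lemma measurable_primitive f (t0 : bool) :
  mu.-integrable [set: T] (EFin \o f) ->
  measurable_fun [set: T]
    (fun t : T => \int[mu]_(x in [set` Interval (BLeft a) (BSide t0 t)]) f x).
Proof.
move=> intf; have mlt := measurable_stieltjes_lt.
pose E : set (T * T) := [set z | (a <= (z.1 : R)) && (z.1 < z.2 ?<= if ~~ t0)].
have mE : measurable E.
  have -> : E = (fst @^-1` (`[a, +oo[%classic : set T)) `&`
      (if t0 then [set z | (z.1 : R) < z.2]
       else ~` (unstable.swap @^-1` [set z | (z.1 : R) < z.2])).
    rewrite /E; case: t0 {E}; apply/seteqP; split => z /=; rewrite in_itv/= andbT.
    - by move=> /andP.
    - by move=> [-> ->].
    - by move=> /andP[-> /=]; rewrite leNgt => /negP.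
    - by move=> [->] /negP; rewrite -leNgt.
  apply: measurableI.
    by rewrite -[X in measurable X]setTI; apply: measurable_fst.
  case: t0 {E} => //; apply: measurableC.
  by rewrite -[X in measurable X]setTI; apply: measurable_swap.
have := @measurable_Rintegral_section _ T R fmu f E intf mE.
congr measurable_fun; apply/funext => t; rewrite [RHS]Rintegral_indic.
by apply: eq_Rintegral => x _; congr (_ * _); rewrite !indicE; congr (_%:R).
Qed.

Lemma normr_Rintegral_le f (A B : set T) : measurable A -> measurable B ->
  A `<=` B -> mu.-integrable [set: T] (EFin \o f) ->
  `|\int[mu]_(x in A) f x| <= \int[mu]_(x in B) `|f x|.
Proof.
move=> mA mB AB intf; rewrite (le_trans (le_normr_Rintegral _ _))//.
  exact: stieltjes_integrableS.
have intn := integrable_norm intf.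
rewrite Rintegral_indic [leRHS]Rintegral_indic; apply: le_Rintegral => //.
- exact: integrable_mul_indic.
- exact: integrable_mul_indic.
- move=> x _; rewrite ler_wpM2l// !indicE ler_nat.
  by case: (boolP (x \in A)) => // /set_mem/AB/mem_set ->.
Qed.

(** The first factor is measurable and bounded by [|c| + \int |f|], so multiplying by it preserves
    integrability. *)
Lemma integrable_mul_primitive f h c t0 :
  mu.-integrable [set: T] (EFin \o f) -> mu.-integrable [set: T] (EFin \o h) ->
  mu.-integrable [set: T] (EFin \o (fun t =>
    (c + \int[mu]_(x in [set` Interval (BLeft a) (BSide t0 t)]) f x) * h t)).
Proof.
move=> intf inth.
pose P := (fun t : T => c + \int[mu]_(x in [set` Interval (BLeft a) (BSide t0 t)]) f x).
apply: (@integrableMr _ T R mu _ measurableT P _ _ _ inth).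

  exact: (measurable_funD (measurable_cst _) (measurable_primitive t0 intf)).
exists (`|c| + \int[mu]_x `|f x|); split; first exact: num_real.
move=> M /ltW cM t _ /=; rewrite (le_trans (ler_normD _ _))//.
by rewrite (le_trans _ cM)// lerD2l; exact: normr_Rintegral_le.
Qed.

(** Once the terms with [c] and [d] are isolated, the product of the integrals of [f] and [h]
    remains to be split along the triangle [s < t]. Its complement contains the diagonal, hence the
    closed interval [[a, t]] in the second integral. *)
Lemma stieltjes_integration_by_parts f h c d :
  mu.-integrable [set: T] (EFin \o f) -> mu.-integrable [set: T] (EFin \o h) ->
  \int[mu]_(t in I) ((c + \int[mu]_(x in `[a, t[) f x) * h t)
  + \int[mu]_(t in I) (f t * (d + \int[mu]_(x in `[a, t]) h x))
  = (c + \int[mu]_(x in I) f x) * (d + \int[mu]_(x in I) h x) - c * d.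
Proof.
move=> intf inth; have mI : measurable (I : set T) by [].
have intF := integrable_mul_primitive 0 true intf inth.
have intH := integrable_mul_primitive 0 false inth intf.
have split1 : \int[mu]_(t in I) ((c + \int[mu]_(x in `[a, t[) f x) * h t) =
    c * \int[mu]_(t in I) h t
    + \int[mu]_(t in I) ((\int[mu]_(x in `[a, t[) f x) * h t).
  rewrite -RintegralZl//; last exact: stieltjes_integrableS.
  rewrite -RintegralD//.
  - by apply: eq_Rintegral => t _; rewrite mulrDl.
  - by apply: (@integrableZl _ T _ mu _ mI c (EFin \o h)); exact: stieltjes_integrableS.
  - apply: stieltjes_integrableS => //; apply: eq_integrable intF => // t _ /=.
    by rewrite add0r.
have split2 : \int[mu]_(t in I) (f t * (d + \int[mu]_(x in `[a, t]) h x)) =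
    d * \int[mu]_(t in I) f t
    + \int[mu]_(t in I) (f t * (\int[mu]_(x in `[a, t]) h x)).
  rewrite -RintegralZl//; last exact: stieltjes_integrableS.
  rewrite -RintegralD//.
  - by apply: eq_Rintegral => t _; rewrite mulrDr mulrC.
  - by apply: (@integrableZl _ T _ mu _ mI d (EFin \o f)); exact: stieltjes_integrableS.
  - apply: stieltjes_integrableS => //; apply: eq_integrable intH => // t _ /=.
    by rewrite add0r mulrC.
(* Fubini runs over the whole line, so both densities are first cut off to [I]. For [t] in [I], the
   sections of the triangle and of its complement then become [[a, t[] and [[a, t]]. *)
have := @Rintegral_prod_split _ T R fmu _ _ _
  (integrable_mul_indic mI intf) (integrable_mul_indic mI inth)
  measurable_stieltjes_lt.
rewrite /= -!Rintegral_indic => prod_split.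
rewrite split1 split2 addrACA [X in _ + X](_ : _ =
  \int[mu]_(x in I) f x * \int[mu]_(x in I) h x); first by ring.
rewrite -{}prod_split; congr (_ + _).
  rewrite Rintegral_indic; apply: eq_Rintegral => t _.
  rewrite -mulrA [\1_ _ t]indicE; case: (boolP (t \in (I : set T))) => [tI|_];
    last by rewrite !mulr0.
  congr (_ * _); rewrite [LHS]Rintegral_indic; apply: eq_Rintegral => s _.
  move: tI; rewrite inE/= in_itv/= => /andP[_ tb].
  rewrite -mulrA; congr (_ * _); rewrite !indicE -natrM mulnb; congr (_%:R).
  congr nat_of_bool; apply/idP/andP; rewrite !inE/= !in_itv/=.
    by move=> /andP[-> st]; rewrite st (lt_trans st tb).
  by move=> [/andP[-> _] ->].
rewrite Rintegral_indic; apply: eq_Rintegral => t _.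
rewrite mulrAC [\1_ _ t]indicE; case: (boolP (t \in (I : set T))) => [tI|_];
    last by rewrite !mulr0 !mul0r.
congr (_ * _); rewrite [LHS]Rintegral_indic; apply: eq_Rintegral => s _.
move: tI; rewrite inE/= in_itv/= => /andP[_ tb].
rewrite -mulrA; congr (_ * _); rewrite !indicE -natrM mulnb; congr (_%:R).
congr nat_of_bool; apply/idP/andP; rewrite !inE/= !in_itv/=.
  by move=> /andP[-> st]; rewrite (le_lt_trans st tb)/=; split => //;
    apply/negP; rewrite -leNgt.
by move=> [/andP[-> _] /negP]; rewrite -leNgt.
Qed.

(** The intervals []t, t + 1/(n+1)[] decrease to the empty set, so their measures tend to 0, and
    absolute continuity of the integral applies. A possible atom at [t] is excluded by the open left
    end. *)
Lemma Rintegral_right_small f t (e : R) : 0 < e ->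
  mu.-integrable [set: T] (EFin \o f) ->
  exists2 x, t < x & \int[mu]_(y in `]t, x[) `|f y| < e.
Proof.
move=> e0 intf; have [d [d0 small]] := integral_normr_continuous intf e0.
pose F (n : nat) : set T := `]t, t + n.+1%:R^-1[%classic.
have F0 : \bigcap_n F n = set0.
  rewrite -subset0 => y Fy; have := Fy 0%N Logic.I; rewrite /F /= in_itv/= => /andP[ty _].
  have yt : 0 < y - t by rewrite subr_gt0.
  have [n _ ny] : \forall n \near \oo, n.+1%:R^-1 < y - t :> R.
    exact: near_infty_natSinv_lt (PosNum yt).
  have := Fy n Logic.I; rewrite /F /= in_itv/= => /andP[_].
  by rewrite -ltrBlDl ltNge (ltW (ny n (leqnn n))).
have mF n : measurable (F n) by exact: measurable_stieltjes_itv.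
have : mu \o F @ \oo --> mu (\bigcap_n F n).
  apply: nonincreasing_cvg_mu => //.
  - apply: le_lt_trans stieltjes_measure_lty.
    by apply: le_measure; rewrite ?inE.
  - by rewrite F0.
  - move=> m n mn; apply/subsetPset => y; rewrite /F /= !in_itv/= => /andP[-> yn].
    by rewrite (lt_le_trans yn)// lerD2l lef_pV2 ?posrE// ler_nat.
rewrite F0 measure0 => /(_ [set r | (r < d%:E)%E]) muF.
have [|N _ /(_ N (leqnn N)) /= FN] := muF.
  by apply: open_nbhs_nbhs; split; [exact: open_ereal_lt_ereal|rewrite /= lte_fin].
by exists (t + N.+1%:R^-1); [rewrite ltrDl|exact: small].
Qed.

Lemma Rintegral_itv_cc f t : a <= t -> mu.-integrable [set: T] (EFin \o f) ->
  forall x, t < x ->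
  \int[mu]_(y in `[a, x[) f y
  = \int[mu]_(y in `[a, t]) f y + \int[mu]_(y in `]t, x[) f y.
Proof.
move=> lat intf x tx.
rewrite (@itv_bndbnd_setU _ _ (BLeft a) (BRight t) (BLeft x)) ?bnd_simp//.
rewrite Rintegral_setU//.
  by apply: stieltjes_integrableS => //; exact: measurableU.
apply/disj_setPS => y [] /=; rewrite !in_itv/= => /andP[_ yt] /andP[ty _].
by move: yt; rewrite leNgt ty.
Qed.

Lemma Rintegral_itv_set1 f t : a <= t -> mu.-integrable [set: T] (EFin \o f) ->
  \int[mu]_(y in `[a, t]) f y
  = \int[mu]_(y in `[a, t[) f y + \int[mu]_(y in [set t]) f y.
Proof.
move=> lat intf; rewrite -(set_itv1 t).
rewrite (@itv_bndbnd_setU _ _ (BLeft a) (BLeft t) (BRight t)) ?bnd_simp//.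
rewrite Rintegral_setU//.
  by apply: stieltjes_integrableS => //; exact: measurableU.
apply/disj_setPS => y [] /=; rewrite !in_itv/= => /andP[_ yt] /andP[ty _].
by move: yt; rewrite ltNge ty.
Qed.

(** The difference is the integral over []t, x[], which is small for [x] near [t]; the atom at [t]
    belongs to the limit. *)
Lemma primitive_cvg_right f t (e : R) : a <= t -> 0 < e ->
  mu.-integrable [set: T] (EFin \o f) ->
  \forall x \near t^'+,
  `|\int[mu]_(y in `[a, x[) f y - \int[mu]_(y in `[a, t]) f y| < e.
Proof.
move=> lat e0 intf; have [x0 tx0 small] := Rintegral_right_small t e0 intf.
near=> x; have tx : t < x by near: x; exact: nbhs_right_gt.
have xx0 : x < x0 by near: x; exact: nbhs_right_lt.
rewrite (Rintegral_itv_cc lat intf tx) addrAC subrr add0r.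
apply: le_lt_trans small; apply: normr_Rintegral_le => // y /=.
by rewrite !in_itv/= => /andP[-> /lt_trans->].
Unshelve. all: by end_near. Qed.

(** For [x] beyond [t], [g x] exceeds [g t] by the mass of [t] and the mass of []t, x[]; the latter
    vanishes in the limit, by the smallness lemma with density 1. So jumps are the masses of
    atoms. *)
Lemma integrator_cvg_right t : a <= t -> t < b ->
  g x @[x --> t^'+] --> g t + fine (mu [set t]).
Proof.
move=> lat tb; have m1 : measurable ([set t] : set T) by rewrite -(set_itv1 t).
apply/cvgrPdist_lt => e e0.
have int1 := stieltjes_integrable_cst 1.
have [x0 tx0 small] := Rintegral_right_small t e0 int1.
near=> x; have tx : t < x by near: x; exact: nbhs_right_gt.
have xx0 : x < x0 by near: x; exact: nbhs_right_lt.
have xb : x <= b by near: x; exact: nbhs_right_ltW.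
have gx : g x = g t + fine (mu [set t]) + fine (mu `]t, x[%classic).
  have := stieltjes_measure_itv g lat (ltW tx) xb.
  rewrite (@itv_bndbnd_setU _ _ (BLeft t) (BRight t) (BLeft x)) ?bnd_simp//.
  rewrite set_itv1 measureU//; last first.
    by rewrite -subset0 => y [/= ->]; rewrite in_itv/= ltxx.
  move=> /(congr1 fine); rewrite fineD ?stieltjes_fin_num//= => mx.
  by rewrite -addrA mx addrC subrK.
rewrite gx opprD addrA subrr add0r normrN ger0_norm ?fine_ge0//.
apply: le_lt_trans small.
have -> : \int[mu]_(y in `]t, x0[) `|(1 : R)| = fine (mu `]t, x0[%classic).
  by rewrite normr1 Rintegral_cst// mul1r.
apply: fine_le; rewrite ?stieltjes_fin_num//.
apply: le_measure; rewrite ?inE//.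
by move=> y; rewrite /= !in_itv/= => /andP[-> /lt_trans->].
Unshelve. all: by end_near. Qed.

Lemma jumpE t : a <= t -> t < b -> jump g t = fine (mu [set t]).
Proof.
move=> lat tb; rewrite /jump (cvg_lim _ (integrator_cvg_right lat tb))//.
by rewrite addrC addKr.
Qed.

Lemma Rintegral_not_jump f t : a <= t -> t < b -> ~ jump_points g t ->
  mu.-integrable [set: T] (EFin \o f) -> \int[mu]_(y in [set t]) f y = 0.
Proof.
move=> lat tb nj intf.
have m1 : measurable ([set t] : set T) by rewrite -(set_itv1 t).
rewrite /Rintegral null_set_integral//.
  by have /measurable_int := stieltjes_integrableS m1 intf.
apply/eqP; rewrite eq_le measure_ge0 andbT leNgt; apply/negP => mut; apply: nj.
split; first by rewrite in_itv/= lat.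
rewrite jumpE// fine_gt0// mut/=.
by rewrite -ge0_fin_numE// stieltjes_fin_num.
Qed.

End stieltjes_theory.

(** * A density is determined by its primitive *)

Section stieltjes_uniqueness.
Context {R : realType} {a b : R} (g : integrator a b).
Hypothesis ab : a <= b.
Local Notation T := (stieltjes_space g).
Local Notation mu := (stieltjes_measure g).
Local Notation I := (`[a, b[%classic : set R).
Implicit Types (f : R -> R).
#[local] Hint Resolve measurable_stieltjes_itv : core.

Lemma Rintegral_stieltjesI f (D : set T) : measurable D ->
  mu.-integrable [set: T] (EFin \o f) ->
  \int[mu]_(x in D) f x = \int[mu]_(x in I `&` D) f x.
Proof.
move=> mD intf; rewrite Rintegral_indic Rintegral_stieltjesT//; last first.
  exact: integrable_mul_indic.
rewrite Rintegral_mkcondr; apply: eq_Rintegral => x _.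
by rewrite patchE indicE; case: ifPn; rewrite ?mulr1 ?mulr0.
Qed.

Lemma Rintegral_setD f (A B : set T) : measurable A -> measurable B ->
  A `<=` B -> mu.-integrable [set: T] (EFin \o f) ->
  \int[mu]_(x in B) f x = \int[mu]_(x in A) f x + \int[mu]_(x in B `\` A) f x.
Proof.
move=> mA mB AB intf; have mBA : measurable (B `\` A) by exact: measurableD.
rewrite -Rintegral_setU//.
- by rewrite setDUK.
- by apply: stieltjes_integrableS => //; exact: measurableU.
- by apply/disj_setPS => x [Ax [_]].
Qed.

(** Dynkin induction from the rays []-oo, x[], which are stable under intersection and generate the
    Borel sets; complements use that the integral over the line vanishes. *)
Lemma Rintegral_borel_eq0 f : mu.-integrable [set: T] (EFin \o f) ->
  (forall t, t \in `[a, b] -> \int[mu]_(x in `[a, t[) f x = 0) ->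
  forall A : set (measurableTypeR R), measurable A -> \int[mu]_(x in A) f x = 0.
Proof.
move=> intf f0 A mA.
have fT : \int[mu]_x f x = 0.
  by rewrite Rintegral_stieltjesT// f0// in_itv/= ab lexx.
apply: (@dynkin_induction _ (measurableTypeR R) (@RGenInftyO.G R)
    (fun A => \int[mu]_(x in (A : set T)) f x = 0)) => //.
- exact: RGenInftyO.measurableE.
- move=> _ _ [x ->] [y ->]; exists (Num.min x y).
  by apply/seteqP; split => z /=; rewrite !in_itv/= lt_min => /andP.
- move=> _ [x ->]; rewrite Rintegral_stieltjesI//.
  (* Clamping [x] to [[a, b]] makes the trace of the ray on [I] one of the intervals covered by the
     hypothesis. *)
  have -> : I `&` `]-oo, x[ = `[a, Num.max a (Num.min x b)[%classic.
    apply/seteqP; split=> z /=; rewrite !in_itv/= lt_max lt_min.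
      by move=> [/andP[-> ->] ->]; rewrite orbT.
    by move=> /andP[az /orP[|/andP[-> ->]]]; [rewrite ltNge az|rewrite az].
  by apply: f0; rewrite in_itv/= le_max lexx/= ge_max ab/= ge_min lexx orbT.
- move=> S mS S0; have mS' := measurable_borel g mS.
  have := Rintegral_setD mS' measurableT (@subsetT _ S) intf.
  by rewrite fT S0 add0r setTD => <-.
- move=> F mF tF F0; have mF' n := measurable_borel g (mF n).
  rewrite /Rintegral integral_bigcup//; last first.
    by apply: stieltjes_integrableS => //; exact: bigcup_measurable.
  rewrite eseries0// => n _ _.
  have := F0 n; rewrite /Rintegral => Fn.
  by rewrite -[LHS]fineK ?Fn//; apply: integrable_fin_num => //;
    exact: stieltjes_integrableS.
- suff : (@RGenInftyO.G R).-sigma.-measurable A by [].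
  by rewrite -RGenInftyO.measurableE.
Qed.

(* A Caratheodory-measurable set is contained in a Borel set, a countable
   union of a cover, of almost the same measure. *)
Lemma Rintegral_stieltjes_eq0 f : mu.-integrable [set: T] (EFin \o f) ->
  (forall t, t \in `[a, b] -> \int[mu]_(x in `[a, t[) f x = 0) ->
  forall A : set T, measurable A -> \int[mu]_(x in A) f x = 0.
Proof.
move=> intf f0 A mA; apply/eqP; rewrite -normr_le0; apply/ler_addgt0Pr => e e0.
rewrite add0r; have [d [d0 small]] := integral_normr_continuous intf e0.
have Afin : mu A \is a fin_num.
  rewrite ge0_fin_numE//; apply: le_lt_trans (stieltjes_measure_lty g ab).
  by apply: le_measure; rewrite ?inE.
have [_ [F [mF AF] <-] Fd] := lb_ereal_inf_adherent d0 Afin.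
pose B := \bigcup_k F k.
have mB : measurable (B : set (measurableTypeR R)) by exact: bigcup_measurable.
have mB' := measurable_borel g mB.
have muB : (mu B < mu A + d%:E)%E.
  apply: le_lt_trans Fd.
  apply: (le_trans (outer_measure_sigma_subadditive
    (mu_ext (stieltjes_borel_measure g)) F)).
  apply: lee_nneseries => // n _; rewrite le_eqVlt; apply/orP; left; apply/eqP.
  exact: (@measurable_mu_extE _ R _ (stieltjes_borel_measure g) _ (mF n)).
have mBA : measurable (B `\` A : set T) by exact: measurableD.
have muBA : (mu (B `\` A) < d%:E)%E.
  rewrite measureD//; last first.
    by apply: lt_le_trans muB _; rewrite leey.
  by rewrite setIidr// lteBlDl.
have := Rintegral_setD mA mB' AF intf.
(* The integral over the Borel set [B] is 0, so the integral over [A] is the opposite of that over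
   the excess of [B], whose measure is below [d]. *)
rewrite (Rintegral_borel_eq0 intf f0 mB) => /esym/eqP; rewrite addr_eq0 => /eqP->.
rewrite normrN; apply: ltW; apply: le_lt_trans (small _ mBA muBA).
by apply: le_normr_Rintegral => //; exact: stieltjes_integrableS.
Qed.

Lemma stieltjes_ae_eq0 f : mu.-integrable [set: T] (EFin \o f) ->
  (forall A : set T, measurable A -> \int[mu]_(x in A) f x = 0) ->
  f = cst 0 %[ae mu].
Proof.
move=> intf f0.
have : ae_eq mu setT (EFin \o f) (cst 0%E).
  apply: (integral_ae_eq measurableT intf (@measurable_cst _ _ _ _ _ _)).
  move=> E _ mE; rewrite [RHS]integral0.
  rewrite -[LHS]fineK; first by have := f0 _ mE; rewrite /Rintegral => ->.
  by apply: integrable_fin_num => //; exact: stieltjes_integrableS.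
by apply: filterS => x /(_ Logic.I) [].
Qed.

(* If [W t <> 0], let [t'] be the infimum of the zeros of [W] beyond [t]: then
   [t, t'[ is null, so W t' <> 0, hence t' is not an atom and W is continuous
   from the right at t', a limit of zeros. *)
Lemma primitive_eq0_everywhere f : mu.-integrable [set: T] (EFin \o f) ->
  (fun t => \int[mu]_(x in `[a, t[) f x) = cst 0 %[ae mu] ->
  \int[mu]_(x in `[a, b[) f x = 0 ->
  forall t, t \in `[a, b] -> \int[mu]_(x in `[a, t[) f x = 0.
Proof.
move=> intf W0 Wb t; rewrite in_itv/= => /andP[lat tb].
set W := fun t => \int[mu]_(x in `[a, t[) f x in W0 *; rewrite -/(W t).
apply: contrapT => Wt.
have nullW (D : set T) : measurable D -> (forall x, D x -> W x <> 0) ->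
    \int[mu]_(x in D) f x = 0.
  move=> mD DW; rewrite /Rintegral null_set_integral//.
    by have /measurable_int := stieltjes_integrableS mD intf.
  case: W0 => N [mN N0 WN]; apply/eqP; rewrite eq_le measure_ge0 andbT -N0.
  apply: le_measure; rewrite ?inE// => x Dx; apply: WN => /= Wx.
  by apply: (DW _ Dx); exact: Wx.
pose Z := [set x | [/\ t <= x, x <= b & W x = 0]].
have Zb : Z b by [].
have Zinf : has_inf Z by split; [exists b|exists t => x []].
pose t' := inf Z.
have tt' : t <= t' by apply: lb_le_inf; [exists b|move=> x []].
have t'b : t' <= b by apply: ge_inf => //; exact: Zinf.2.
have ltZ x : t <= x -> x < t' -> W x <> 0.
  move=> tx xt' Wx; suff : t' <= x by rewrite leNgt xt'.
  apply: ge_inf; first exact: Zinf.2.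
  by split => //; rewrite (le_trans (ltW xt')).
have Wt' : W t' <> 0.
  rewrite /W (Rintegral_itv_split lat tt' intf) -/(W t).
  rewrite (nullW `[t, t'[%classic) ?addr0// => x /=; rewrite in_itv/= => /andP[].
  exact: ltZ.
have e0 : 0 < `|W t'| by rewrite normr_gt0; apply/eqP.
have [x tx small] := Rintegral_right_small ab t' e0 intf.
have tx0 : 0 < x - t' by rewrite subr_gt0.
have [z [tz zb Wz]] := inf_adherent tx0 Zinf.
rewrite -/t' addrC subrK => zx.
have tz' : t' < z.
  have : t' <= z by apply: ge_inf; [exact: Zinf.2|].
  by rewrite le_eqVlt => /predU1P[t'z|//]; rewrite -t'z in Wz.
have lat' : a <= t' by exact: le_trans tt'.
(* From [a] to the zero [z], the integral consists of [W t'], the null contribution of the point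
   [t'], and the integral over []t', z[]. The last is smaller in modulus than [W t'], yet must
   cancel it. *)
have := Rintegral_itv_cc lat' intf tz'.
rewrite -/(W z) Wz Rintegral_itv_set1// -/(W t').
rewrite (nullW [set t']); [|by rewrite -(set_itv1 t')|by move=> y /= ->].
rewrite addr0 => /esym/eqP; rewrite addr_eq0 => /eqP Wt'E.
suff : `|W t'| < `|W t'| by rewrite ltxx.
rewrite {1}Wt'E normrN; apply: le_lt_trans small.
apply: normr_Rintegral_le => // y /=.
by rewrite !in_itv/= => /andP[-> /lt_trans->].
Qed.

End stieltjes_uniqueness.

(** * Scalar primitives as Sobolev functions, and their posterior traces *)

Section stieltjes_primitive.
Context {R : realType} (k : scalar_kind) {a b : R} (g : integrator a b).
Hypothesis ab : a <= b.
Local Notation F := (scalar_field R k).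
Local Notation T := (stieltjes_space g).
Local Notation mu := (stieltjes_measure g).
Local Notation I := (`[a, b[%classic : set R).
Implicit Types (c : F) (u v Phi phi : R -> F) (t : R).
#[local] Hint Resolve measurable_stieltjes_itv : core.

Definition primitive c v t : F := c + scalar_integral mu (`[a, t[%classic) v.

Lemma scalar_Re_primitive c v t : scalar_Re (primitive c v t) =
  scalar_Re c + \int[mu]_(x in `[a, t[) scalar_Re (v x).
Proof. by rewrite scalar_ReD scalar_Re_integral. Qed.

Lemma scalar_Im_primitive c v t : scalar_Im (primitive c v t) =
  scalar_Im c + \int[mu]_(x in `[a, t[) scalar_Im (v x).
Proof. by rewrite scalar_ImD scalar_Im_integral. Qed.

Lemma primitive_left c v : primitive c v a = c.
Proof.
rewrite /primitive set_itvco0 (_ : scalar_integral _ _ _ = 0) ?addr0//.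
apply: scalar_eq; rewrite ?scalar_Re_integral ?scalar_Im_integral.
  by rewrite Rintegral_set0 scalar_Re0.
by rewrite Rintegral_set0 scalar_Im0.
Qed.

Lemma scalar_measurable_primitive c v : in_Lp mu 1 v ->
  @scalar_measurable _ T _ k (primitive c v).
Proof.
move=> Lv; split.
  have := measurable_funD (@measurable_cst _ _ T _ setT (scalar_Re c))
    (measurable_primitive ab true (in_L1_Re Lv)).
  by congr measurable_fun; apply/funext => t /=; rewrite scalar_Re_primitive.
have := measurable_funD (@measurable_cst _ _ T _ setT (scalar_Im c))
  (measurable_primitive ab true (in_L1_Im Lv)).
by congr measurable_fun; apply/funext => t /=; rewrite scalar_Im_primitive.
Qed.

Lemma scalar_abs_primitive_le c v t : in_Lp mu 1 v ->
  scalar_abs (primitive c v t) <= scalar_abs c + 2 * \int[mu]_x scalar_abs (v x).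
Proof.
move=> Lv; rewrite (le_trans (scalar_absD _ _))// lerD2l.
rewrite (le_trans (scalar_integral_abs_le _ Lv))// ler_pM2l//.
have := normr_Rintegral_le (measurable_stieltjes_itv g `[a, t[) measurableT
  (@subsetT _ _) (in_L1_abs Lv).
rewrite ger0_norm; last by apply: Rintegral_ge0 => x _; exact: scalar_abs_ge0.
move=> /le_trans; apply; rewrite le_eqVlt; apply/orP; left; apply/eqP.
by apply: eq_Rintegral => x _; rewrite ger0_norm ?scalar_abs_ge0.
Qed.

Lemma primitive_in_Lp p c v : (1 <= p)%E -> in_Lp mu 1 v ->
  in_Lp mu p (primitive c v).
Proof.
move=> p1 Lv; apply: (bounded_in_Lp (stieltjes_measure_lty g ab) p1).
  exact: scalar_measurable_primitive.
by move=> t; exact: scalar_abs_primitive_le.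
Qed.

Lemma primitive_sub c v s t : a <= s -> s <= t -> in_Lp mu 1 v ->
  primitive c v t - primitive c v s = scalar_integral mu (`[s, t[%classic) v.
Proof.
move=> las st Lv; apply: scalar_eq.
  rewrite scalar_ReB !scalar_Re_primitive scalar_Re_integral.
  rewrite (Rintegral_itv_split las st (in_L1_Re Lv)); ring.
rewrite scalar_ImB !scalar_Im_primitive scalar_Im_integral.
rewrite (Rintegral_itv_split las st (in_L1_Im Lv)); ring.
Qed.

(** Increments are integrals over the intervals [[s j, t j[], and the measure of their disjoint
    union is the sum of the increments of [g]. The claim is then absolute continuity of the integral
    of the modulus. *)
Lemma primitive_abs_continuous c v : in_Lp mu 1 v ->
  abs_continuous_wrt g (primitive c v).
Proof.
move=> Lv e e0; have iv := in_L1_abs Lv.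
(* Halving [e] compensates the factor 2 of [scalar_integral_abs_le]. *)
have e20 : 0 < e / 2 by rewrite divr_gt0.
have [d [d0 small]] := integral_normr_continuous iv e20.
exists d => // n s t st tst gst.
pose A (j : 'I_n) : set T := `[s j, t j[%classic.
have mA j : measurable (A j) by exact: measurable_stieltjes_itv.
have mUA : measurable (\big[setU/set0]_(j < n) A j) by exact: bigsetU_measurable.
have /small : (mu (\big[setU/set0]_(j < n) A j) < d%:E)%E.
  rewrite measure_bigsetU_ord//.
  rewrite (eq_bigr (fun j => (g (t j) - g (s j))%:E)); last first.
    move=> j _; have [asj stj tjb] := st j.
    exact: (stieltjes_measure_itv g asj (ltW stj) tjb).
  by rewrite sumEFin lte_fin.
move=> /(_ mUA) {}small.
apply: (@le_lt_trans _ _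
  (2 * \int[mu]_(x in \big[setU/set0]_(j < n) A j) `|scalar_abs (v x)|)); last first.
  by rewrite mulrC -ltr_pdivlMr.
have absE j : \int[mu]_(x in A j) scalar_abs (v x) =
    \int[mu]_(x in A j) `|scalar_abs (v x)|.
  by apply: eq_Rintegral => x _; rewrite ger0_norm ?scalar_abs_ge0.
have -> : \int[mu]_(x in \big[setU/set0]_(j < n) A j) `|scalar_abs (v x)| =
    \sum_(j < n) \int[mu]_(x in A j) `|scalar_abs (v x)|.
  have iA (D : set T) : measurable D ->
      mu.-integrable D (EFin \o (fun x => `|scalar_abs (v x)|)).
    by move=> mD; apply: stieltjes_integrableS => //; exact: integrable_norm iv.
  rewrite /Rintegral (@integral_bigsetU_EFin _ T R mu _ A) ?index_enum_uniq//.
  - by rewrite sum_fine// => j _; apply: integrable_fin_num => //; exact: iA.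
  - by apply: sub_trivIset tst.
  - by have /measurable_int := iA _ mUA.
rewrite mulr_sumr; apply: ler_sum => j _; have [asj stj tjb] := st j.
by rewrite (primitive_sub _ asj (ltW stj) Lv) -absE; exact: scalar_integral_abs_le.
Qed.

Lemma is_stieltjes_derivative_primitive c v : in_Lp mu 1 v ->
  is_stieltjes_derivative g (primitive c v) v.
Proof. by move=> Lv; split => // t _; rewrite primitive_left. Qed.

Lemma sobolev_primitive p c v : (1 <= p)%E -> in_Lp mu p v ->
  sobolev g p (primitive c v).
Proof.
move=> p1 Lv; have L1v := in_Lp_L1 (stieltjes_measure_lty g ab) p1 Lv.
split; first exact: primitive_abs_continuous.
  exact: primitive_in_Lp.
by exists v => //; exact: is_stieltjes_derivative_primitive.
Qed.

(** At a jump point the right limit of the primitive picks up the atom; elsewhere [t] has mass 0,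
    and closing the interval changes nothing. *)
Lemma posterior_traceE Phi phi t : is_stieltjes_derivative g Phi phi ->
  a <= t -> t < b ->
  posterior_trace g Phi t = Phi a + scalar_integral mu (`[a, t]%classic) phi.
Proof.
move=> [Lphi PhiE] lat tb; rewrite /posterior_trace.
have [ir ii] := (in_L1_Re Lphi, in_L1_Im Lphi).
case: ifPn => [_|]; last first.
  move/negP => nj; have {}nj : ~ jump_points g t by move=> ?; apply: nj; rewrite inE.
  rewrite (PhiE t) ?in_itv/= ?lat ?(ltW tb)//; congr (_ + _); apply: scalar_eq.
    rewrite !scalar_Re_integral (Rintegral_itv_set1 lat ir).
    by rewrite (Rintegral_not_jump ab lat tb nj ir) addr0.
  rewrite !scalar_Im_integral (Rintegral_itv_set1 lat ii).
  by rewrite (Rintegral_not_jump ab lat tb nj ii) addr0.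
apply: cvg_lim => //; apply/cvgrPdist_lt => e e0.
(* The tolerance [e] is a scalar here; its real part is shared between the real and imaginary
   components. *)
have e20 : 0 < scalar_Re e / 2 by rewrite divr_gt0// scalar_Re_gt0.
have cr := primitive_cvg_right ab lat e20 ir.
have ci := primitive_cvg_right ab lat e20 ii.
near=> x; have tx : t < x by near: x; exact: nbhs_right_gt.
have xb : x <= b by near: x; exact: nbhs_right_ltW.
rewrite (PhiE x) ?in_itv/= ?xb ?andbT ?(le_trans lat (ltW tx))//.
apply: normr_lt_scalar => //; rewrite -scalar_absN opprB opprD addrACA subrr add0r.
rewrite (le_lt_trans (scalar_abs_le _))// scalar_ReB scalar_ImB.
rewrite !scalar_Re_integral !scalar_Im_integral [ltRHS]splitr ltrD//.
  by near: x; exact: cr.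
by near: x; exact: ci.
Unshelve. all: by end_near. Qed.

Lemma scalar_measurableM u v : @scalar_measurable _ T _ k u ->
  @scalar_measurable _ T _ k v -> @scalar_measurable _ T _ k (fun x => u x * v x).
Proof.
move=> [u1 u2] [v1 v2]; split.
  have := measurable_funB (measurable_funM u1 v1) (measurable_funM u2 v2).
  by congr measurable_fun; apply/funext => x /=; rewrite scalar_ReM.
have := measurable_funD (measurable_funM u1 v2) (measurable_funM u2 v1).
by congr measurable_fun; apply/funext => x /=; rewrite scalar_ImM.
Qed.

(** The real formula is applied to the four pairings of real and imaginary parts of [v] and [phi].
    The closed interval [[a, t]] it requires is the one in the posterior trace. *)
Lemma scalar_integration_by_parts u v c Phi phi :
  @scalar_measurable _ T _ k u -> in_Lp mu 1 v -> u = primitive c v %[ae mu] ->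
  is_stieltjes_derivative g Phi phi ->
  scalar_integral mu I (fun t => u t * phi t)
  + scalar_integral mu I (fun t => v t * posterior_trace g Phi t)
  = primitive c v b * Phi b - c * Phi a.
Proof.
move=> mu_ Lv uE dPhi; have [Lphi PhiE] := dPhi.
have mI : measurable (I : set T) by [].
have mp := scalar_measurable_primitive c Lv.
have -> : scalar_integral mu I (fun t => u t * phi t) =
    scalar_integral mu I (fun t => primitive c v t * phi t).
  apply: (ae_eq_scalar_integral mI).
  - exact: scalar_measurableM mu_ Lphi.1.
  - exact: scalar_measurableM mp Lphi.1.
  - exact: ae_eq_mulr uE.
have -> : scalar_integral mu I (fun t => v t * posterior_trace g Phi t) =
    scalar_integral mu I
      (fun t => v t * (Phi a + scalar_integral mu (`[a, t]%classic) phi)).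
  apply: eq_scalar_integral => t; rewrite inE/= in_itv/= => /andP[lat tb].
  by rewrite (posterior_traceE dPhi).
rewrite (PhiE b) ?in_itv/= ?ab ?lexx//.
have [vr vi] := (in_L1_Re Lv, in_L1_Im Lv).
have [fr fi] := (in_L1_Re Lphi, in_L1_Im Lphi).
have ibp := @stieltjes_integration_by_parts _ _ _ g ab.
have iP (f h : R -> R) (d : R) : mu.-integrable [set: T] (EFin \o f) ->
    mu.-integrable [set: T] (EFin \o h) ->
    mu.-integrable I (EFin \o (fun t => (d + \int[mu]_(x in `[a, t[) f x) * h t)).
  by move=> intf inth; exact: stieltjes_integrableS
    (integrable_mul_primitive ab d true intf inth).
have iQ (f h : R -> R) (d : R) : mu.-integrable [set: T] (EFin \o f) ->
    mu.-integrable [set: T] (EFin \o h) ->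
    mu.-integrable I (EFin \o (fun t => h t * (d + \int[mu]_(x in `[a, t]) f x))).
  move=> intf inth.
  have := stieltjes_integrableS mI (integrable_mul_primitive ab d false intf inth).
  by apply: eq_integrable => // t _ /=; rewrite mulrC.
have Ur := scalar_Re_primitive c v; have Ui := scalar_Im_primitive c v.
have Sr t : scalar_Re (Phi a + scalar_integral mu (`[a, t]%classic) phi) =
    scalar_Re (Phi a) + \int[mu]_(x in `[a, t]) scalar_Re (phi x).
  by rewrite scalar_ReD scalar_Re_integral.
have Si t : scalar_Im (Phi a + scalar_integral mu (`[a, t]%classic) phi) =
    scalar_Im (Phi a) + \int[mu]_(x in `[a, t]) scalar_Im (phi x).
  by rewrite scalar_ImD scalar_Im_integral.
apply: scalar_eq.
  rewrite scalar_ReD scalar_ReB !scalar_ReM !scalar_Re_integral.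
  rewrite Ur Ui !scalar_ReD !scalar_ImD !scalar_Re_integral !scalar_Im_integral.
  have brr := ibp _ _ (scalar_Re c) (scalar_Re (Phi a)) vr fr.
  have bii := ibp _ _ (scalar_Im c) (scalar_Im (Phi a)) vi fi.
  under eq_Rintegral do rewrite scalar_ReM Ur Ui.
  under [X in _ + X = _]eq_Rintegral do rewrite scalar_ReM Sr Si.
  rewrite (RintegralB mI (iP _ _ _ vr fr) (iP _ _ _ vi fi)).
  rewrite (RintegralB mI (iQ _ _ _ fr vr) (iQ _ _ _ fi vi)).
  by move: brr bii; lra.
rewrite scalar_ImD scalar_ImB !scalar_ImM !scalar_Im_integral.
rewrite Ur Ui !scalar_ReD !scalar_ImD !scalar_Re_integral !scalar_Im_integral.
have bri := ibp _ _ (scalar_Re c) (scalar_Im (Phi a)) vr fi.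
have bir := ibp _ _ (scalar_Im c) (scalar_Re (Phi a)) vi fr.
under eq_Rintegral do rewrite scalar_ImM Ur Ui.
under [X in _ + X = _]eq_Rintegral do rewrite scalar_ImM Sr Si.
rewrite (RintegralD mI (iP _ _ _ vr fi) (iP _ _ _ vi fr)).
rewrite (RintegralD mI (iQ _ _ _ fi vr) (iQ _ _ _ fr vi)).
by move: bri bir; lra.
Qed.

End stieltjes_primitive.

(** * Representatives of L^p classes *)

Section Lp_space_theory.
Context {d} {T : measurableType d} {R : realType} (k : scalar_kind).
Variables (mu : {measure set T -> \bar R}) (p : \bar R) (p1 : (1 <= p)%E).
Local Notation F := (scalar_field R k).
Local Notation Lpmu := (Lp_space k mu p1).
Implicit Types (u w : Lpmu) (c : F) (f : T -> F).

Lemma Lp_repr_in_Lp u : in_Lp mu p (Lp_repr u).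
Proof. by rewrite /Lp_repr; case: (repr u) => f /= /asboolP. Qed.

(** Representatives are chosen class by class, so linearity holds only up to a null set. *)
Lemma Lp_reprZD c u w :
  Lp_repr (c *: u + w) = c *: Lp_repr u + Lp_repr w %[ae mu].
Proof.
apply: (Lp_classP (repr (c *: u + w)) (c *: repr u + repr w)).1.
by rewrite raddfD/= Lp_class_scale !Lp_reprK.
Qed.

Lemma Lp_repr0 : Lp_repr (0 : Lpmu) = cst 0 %[ae mu].
Proof.
by apply: (Lp_classP (repr (0 : Lpmu)) 0).1; rewrite Lp_reprK raddf0.
Qed.

Lemma Lp_repr_inj u w : Lp_repr u = Lp_repr w %[ae mu] -> u = w.
Proof. by move=> uw; rewrite -(Lp_reprK u) -(Lp_reprK w); exact/Lp_classP. Qed.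

Lemma Lp_repr_surj f : in_Lp mu p f -> exists u, Lp_repr u = f %[ae mu].
Proof.
move=> Lf; have fP : f \in @Lp_pred _ T R k mu p p1 by exact/asboolP.
exists (Lp_class (LpFun fP)).
by apply: (Lp_classP _ (LpFun fP)).1; rewrite Lp_reprK.
Qed.

Hypothesis mufin : (mu [set: T] < +oo)%E.

Lemma Lp_repr_in_L1 u : in_Lp mu 1 (Lp_repr u).
Proof. exact: in_Lp_L1 (Lp_repr_in_Lp u). Qed.

Lemma L1_le_Lp_norm : exists2 C : R, 0 <= C &
  forall u, \int[mu]_x scalar_abs (Lp_repr u x) <= C * Lp_norm u.
Proof.
have [C C0 HC] := L1_le_Lnorm mufin p1; exists C => // u.
have [mf ff] := Lp_repr_in_Lp u.
have := HC _ (scalar_abs_measurable mf) ff.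
apply: le_trans; rewrite le_eqVlt; apply/orP; left; apply/eqP.
by apply: eq_Rintegral => x _ /=; rewrite ger0_norm ?scalar_abs_ge0.
Qed.

Lemma Lp_norm_ge0 u : 0 <= Lp_norm u.
Proof. by rewrite fine_ge0// Lnorm_ge0. Qed.

End Lp_space_theory.

(* The library's hints fail to infer this filter structure from the measure. *)
#[local] Instance ae_stieltjes_filter (R : realType) (a b : R)
  (g : integrator a b) : Filter (nbhs (almost_everywhere (stieltjes_measure g))).
Proof. exact: (ae_filter_ringOfSetsType (stieltjes_measure g)). Qed.

(** * The weak identity through primitives: uniqueness, linearity, kernel and closedness *)

Section weak_identity_theory.
Context {R : realType} (k : scalar_kind) {a b : R} (g : integrator a b).
Variables (p : \bar R) (p1 : (1 <= p)%E).
Hypothesis ab : a <= b.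
Local Notation F := (scalar_field R k).
Local Notation T := (stieltjes_space g).
Local Notation mu := (stieltjes_measure g).
Local Notation Lpg := (Lp_space k mu p1).
Local Notation I := (`[a, b[%classic : set R).
Implicit Types (x : state_space k g p1) (v : Lpg) (c : F).
#[local] Hint Resolve measurable_stieltjes_itv : core.
Let mufin := stieltjes_measure_lty g ab.
Let L1 v := Lp_repr_in_L1 mufin v.

Lemma ae_stieltjes_itv (P : R -> Prop) : (forall t, a <= t -> t < b -> P t) ->
  \forall t \ae mu, P t.
Proof.
move=> Pt; exists (~` I); split.
- by apply: measurableC; exact: measurable_stieltjes_itv.
- exact: stieltjes_setC_itv.
- move=> t /= nP; rewrite /= in_itv/= => /andP[lat tb]; apply: nP; exact: Pt.
Qed.

Lemma ae_eq_primitive c (v w : R -> F) t : @scalar_measurable _ T _ k v ->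
  @scalar_measurable _ T _ k w -> v = w %[ae mu] ->
  primitive g c v t = primitive g c w t.
Proof.
by move=> mv mw vw; congr (_ + _); exact: ae_eq_scalar_integral vw.
Qed.

Lemma primitiveZD c c1 c2 (v w : R -> F) t : in_Lp mu 1 v -> in_Lp mu 1 w ->
  primitive g (c * c1 + c2) (c *: v + w) t
  = c * primitive g c1 v t + primitive g c2 w t.
Proof.
move=> Lv Lw; rewrite /primitive (scalar_integralZD _ _ Lv Lw)// mulrDr.
by rewrite addrACA.
Qed.

Lemma primitive0 c t : primitive g c (cst 0) t = c.
Proof.
rewrite /primitive (_ : scalar_integral _ _ _ = 0) ?addr0//.
apply: scalar_eq; rewrite ?scalar_Re_integral ?scalar_Im_integral.
  by under eq_Rintegral do rewrite /= scalar_Re0;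
    rewrite Rintegral_cst// mul0r scalar_Re0.
by under eq_Rintegral do rewrite /= scalar_Im0;
    rewrite Rintegral_cst// mul0r scalar_Im0.
Qed.

(** Indicators serve as densities of test functions; being bounded by 1, they lie in L^q for every
    exponent. *)
Lemma scalar_indic_in_Lp q (A : set T) : (1 <= q)%E -> measurable A ->
  in_Lp mu q (fun t => scalar_of k (\1_A t) 0).
Proof.
move=> q1 mA; apply: (bounded_in_Lp mufin (M := 1) q1); first split.
- have -> : @scalar_Re R k \o (fun t => scalar_of k (\1_A t) 0) = \1_A.
    by apply/funext => t /=; rewrite scalar_Re_of.
  exact: measurable_indic.
- have -> : @scalar_Im R k \o (fun t => scalar_of k (\1_A t) 0) = cst 0.
    by apply/funext => t /=; rewrite scalar_Im_of0.
  exact: measurable_cst.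
- move=> t; rewrite (le_trans (scalar_abs_le _))// scalar_Re_of scalar_Im_of0.
  by rewrite normr0 addr0 ger0_norm// indicE; case: (_ \in _).
Qed.

Lemma weak_identityP x v : weak_identity k g p1 x v <->
  Lp_repr x.1 = primitive g x.2.1 (Lp_repr v) %[ae mu] /\
  primitive g x.2.1 (Lp_repr v) b = x.2.2.
Proof.
set P := primitive g _ _; split; last first.
  move=> [uP Pb] Phi phi _ dPhi; rewrite -Pb.
  exact: (scalar_integration_by_parts ab (Lp_repr_in_Lp _).1 (L1 v) uP dPhi).
move=> weak; have q1 := hoelder_conj_ge1 p1.
have mP : @scalar_measurable _ T _ k P by exact: scalar_measurable_primitive.
have PP : P = P %[ae mu] by exact: aeW.
(* Each [phi] is the derivative of a test function whose initial value [c] is free. Subtracting the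
   integration by parts formula for [P] cancels the integral with [v] and the boundary term at
   [a]. *)
have weakP c phi : in_Lp mu (hoelder_conjugate p) phi ->
    scalar_integral mu I (fun t => Lp_repr x.1 t * phi t)
    - scalar_integral mu I (fun t => P t * phi t)
    = (x.2.2 - P b) * primitive g c phi b.
  move=> Lphi; have dphi := is_stieltjes_derivative_primitive c (in_Lp_L1 mufin q1 Lphi).
  have := weak _ _ (sobolev_primitive ab c q1 Lphi) dphi.
  have := scalar_integration_by_parts ab mP (L1 v) PP dphi.
  rewrite -/P !primitive_left; set S := scalar_integral mu I (fun t => Lp_repr v t * _).
  move=> /(canRL (addrK _)) -> /(canRL (addrK _)) ->.
  by rewrite mulrBl opprD addrACA subrr addr0 opprB addrA subrK.
have Pb : x.2.2 = P b.
  apply/eqP; rewrite -subr_eq0; apply/eqP.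
  have L0 : in_Lp mu (hoelder_conjugate p) (cst 0 : R -> F) by exact: in_Lp0.
  (* Density 0 with initial value 1 is the constant test function 1, which isolates the defect at
     [b]. *)
  have := weakP 1 _ L0; rewrite primitive0 mulr1 => <-.
  suff E (f : R -> F) : scalar_integral mu I (fun t => f t * cst 0 t) =
      scalar_integral mu I (cst 0 : R -> F) by rewrite !E subrr.
  by apply: eq_scalar_integral => t _; rewrite /= mulr0.
split=> //; have L1u := L1 x.1.
have L1P : in_Lp mu 1 P by exact: primitive_in_Lp.
(* The defect at [b] is now 0, so the right-hand side vanishes for every test function, and [u] and
   [P] have equal integrals over each measurable set. *)
have weak_indic (A : set T) : measurable A ->
    scalar_integral mu I (fun t => Lp_repr x.1 t * scalar_of k (\1_A t) 0) =
    scalar_integral mu I (fun t => P t * scalar_of k (\1_A t) 0).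
  move=> mA; have := weakP 0 _ (scalar_indic_in_Lp q1 mA).
  by rewrite Pb subrr mul0r => /eqP; rewrite subr_eq0 => /eqP.
have ReE (f : R -> F) (A : set T) : measurable A -> in_Lp mu 1 f ->
    scalar_Re (scalar_integral mu I (fun t => f t * scalar_of k (\1_A t) 0)) =
    \int[mu]_(t in A) scalar_Re (f t).
  move=> mA Lf; rewrite scalar_Re_integral [RHS]Rintegral_indic.
  rewrite Rintegral_stieltjesT//; last exact: integrable_mul_indic mA (in_L1_Re Lf).
  apply: eq_Rintegral => t _.
  by rewrite scalar_ReM scalar_Re_of scalar_Im_of0 mulr0 subr0.
have ImE (f : R -> F) (A : set T) : measurable A -> in_Lp mu 1 f ->
    scalar_Im (scalar_integral mu I (fun t => f t * scalar_of k (\1_A t) 0)) =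
    \int[mu]_(t in A) scalar_Im (f t).
  move=> mA Lf; rewrite scalar_Im_integral [RHS]Rintegral_indic.
  rewrite Rintegral_stieltjesT//; last exact: integrable_mul_indic mA (in_L1_Im Lf).
  apply: eq_Rintegral => t _.
  by rewrite scalar_ImM scalar_Re_of scalar_Im_of0 mulr0 add0r.
have aeRe : (fun t => scalar_Re (Lp_repr x.1 t) - scalar_Re (P t)) = cst 0 %[ae mu].
  apply: stieltjes_ae_eq0.
    exact: (integrableB measurableT (in_L1_Re L1u) (in_L1_Re L1P)).
  move=> A mA; rewrite RintegralB//; [|exact: stieltjes_integrableS (in_L1_Re _)..].
  by rewrite -!ReE// weak_indic// subrr.
have aeIm : (fun t => scalar_Im (Lp_repr x.1 t) - scalar_Im (P t)) = cst 0 %[ae mu].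
  apply: stieltjes_ae_eq0.
    exact: (integrableB measurableT (in_L1_Im L1u) (in_L1_Im L1P)).
  move=> A mA; rewrite RintegralB//; [|exact: stieltjes_integrableS (in_L1_Im _)..].
  by rewrite -!ImE// weak_indic// subrr.
apply: filterS2 aeRe aeIm => t /(_ Logic.I) tr /(_ Logic.I) ti _.
by apply: scalar_eq; apply/eqP; rewrite -subr_eq0; apply/eqP.
Qed.

(** Both components of the difference of densities have a primitive vanishing almost everywhere and
    at [b], hence everywhere. The value at [b] is a separate condition because [mu] does not charge
    [b]. *)
Lemma primitive_inj c (v w : R -> F) : in_Lp mu 1 v -> in_Lp mu 1 w ->
  primitive g c v = primitive g c w %[ae mu] ->
  primitive g c v b = primitive g c w b -> v = w %[ae mu].
Proof.
move=> Lv Lw vw vwb.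
have mI t : measurable (`[a, t[%classic : set T) by exact: measurable_stieltjes_itv.
have part (f h : R -> R) : mu.-integrable [set: T] (EFin \o f) ->
    mu.-integrable [set: T] (EFin \o h) ->
    (fun t => \int[mu]_(x in `[a, t[) f x) =
      (fun t => \int[mu]_(x in `[a, t[) h x) %[ae mu] ->
    \int[mu]_(x in `[a, b[) f x = \int[mu]_(x in `[a, b[) h x ->
    f = h %[ae mu].
  move=> intf inth fh fhb.
  have intB : mu.-integrable [set: T] (EFin \o (fun t => f t - h t)).
    exact: (integrableB measurableT intf inth).
  have BE t : \int[mu]_(x in `[a, t[) (f x - h x) =
      \int[mu]_(x in `[a, t[) f x - \int[mu]_(x in `[a, t[) h x.
    by rewrite RintegralB//; exact: stieltjes_integrableS.
  have B0 : (fun t => \int[mu]_(x in `[a, t[) (f x - h x)) = cst 0 %[ae mu].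
    by move: fh; apply: filterS => t /(_ Logic.I) fht _ /=; rewrite BE fht subrr.
  have Bb : \int[mu]_(x in `[a, b[) (f x - h x) = 0 by rewrite BE fhb subrr.
  have Beq0 := Rintegral_stieltjes_eq0 ab intB (primitive_eq0_everywhere ab intB B0 Bb).
  have := stieltjes_ae_eq0 intB Beq0.
  by apply: filterS => t /(_ Logic.I)/eqP; rewrite subr_eq0 => /eqP.
have reE : (fun t => scalar_Re (v t)) = (fun t => scalar_Re (w t)) %[ae mu].
  apply: (part _ _ (in_L1_Re Lv) (in_L1_Re Lw)).
    move: vw; apply: filterS => t /(_ Logic.I)/(congr1 (@scalar_Re R k)) + _.
    by rewrite !scalar_Re_primitive => /addrI.
  by move/(congr1 (@scalar_Re R k)) : vwb; rewrite !scalar_Re_primitive => /addrI.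
have imE : (fun t => scalar_Im (v t)) = (fun t => scalar_Im (w t)) %[ae mu].
  apply: (part _ _ (in_L1_Im Lv) (in_L1_Im Lw)).
    move: vw; apply: filterS => t /(_ Logic.I)/(congr1 (@scalar_Im R k)) + _.
    by rewrite !scalar_Im_primitive => /addrI.
  by move/(congr1 (@scalar_Im R k)) : vwb; rewrite !scalar_Im_primitive => /addrI.
apply: filterS2 reE imE => t /(_ Logic.I) tr /(_ Logic.I) ti _.
exact: scalar_eq.
Qed.

Lemma weak_identity_inj x v1 v2 :
  weak_identity k g p1 x v1 -> weak_identity k g p1 x v2 -> v1 = v2.
Proof.
move=> /weak_identityP[u1 b1] /weak_identityP[u2 b2]; apply: Lp_repr_inj.
apply: (primitive_inj (L1 v1) (L1 v2) _ (etrans b1 (esym b2))).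
by apply: filterS2 u1 u2 => t /(_ Logic.I) <- /(_ Logic.I) <-.
Qed.

Lemma state_operator_eq x v :
  weak_identity k g p1 x v -> state_operator k g p1 x = v.
Proof. by move=> xv; apply: xget_unique => // w xw; exact: weak_identity_inj xw xv. Qed.

Lemma state_domainP x : state_domain k g p1 x ->
  weak_identity k g p1 x (state_operator k g p1 x).
Proof. by move=> [v xv]; rewrite (state_operator_eq xv). Qed.

(** Representatives are linear only almost everywhere, but integration erases null sets, so the
    identity holds at every [t]. *)
Lemma primitive_reprZD c c1 c2 v1 v2 t :
  primitive g (c * c1 + c2) (Lp_repr (c *: v1 + v2)) t =
  c * primitive g c1 (Lp_repr v1) t + primitive g c2 (Lp_repr v2) t.
Proof.
rewrite -primitiveZD//; apply: ae_eq_primitive; last exact: Lp_reprZD.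
  exact: (L1 _).1.
by apply: scalar_measurableZD; exact: (L1 _).1.
Qed.

Lemma weak_identityZD c x1 x2 v1 v2 :
  weak_identity k g p1 x1 v1 -> weak_identity k g p1 x2 v2 ->
  weak_identity k g p1 (c *: x1 + x2) (c *: v1 + v2).
Proof.
move=> /weak_identityP[u1 b1] /weak_identityP[u2 b2].
have vE := primitive_reprZD c x1.2.1 x2.2.1 v1 v2.
apply/weak_identityP; split; last by rewrite vE b1 b2.
apply: filterS3 u1 u2 (Lp_reprZD c x1.1 x2.1) => t /(_ Logic.I) h1 /(_ Logic.I) h2.
move=> /(_ Logic.I) h _; rewrite h vE.
by rewrite [LHS](_ : _ = c * Lp_repr x1.1 t + Lp_repr x2.1 t)// h1 h2.
Qed.

(** The primitive of the zero class is constant; this gives the kernel. *)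
Lemma weak_identity0P x : weak_identity k g p1 x 0 <->
  Lp_repr x.1 = cst x.2.1 %[ae mu] /\ x.2.1 = x.2.2.
Proof.
have prim0 t : primitive g x.2.1 (Lp_repr (0 : Lpg)) t = x.2.1.
  have := ae_eq_primitive x.2.1 t (L1 (0 : Lpg)).1
    (in_Lp0 k mu (lexx 1%E)).1 (Lp_repr0 k mu p1).
  by move=> ->; exact: primitive0.
rewrite weak_identityP prim0; split=> -[uE bE]; split=> //.
  by move: uE; apply: filterS => t /(_ Logic.I) ->.
by move: uE; apply: filterS => t /(_ Logic.I) ->; rewrite prim0.
Qed.

Lemma scaleN1_funE (f h : R -> F) t : ((-1) *: f + h) t = h t - f t.
Proof. by rewrite [LHS](_ : _ = -1 * f t + h t)// mulN1r addrC. Qed.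

(** The L^1 norm of the class is controlled by its L^p norm, and the primitive is bounded uniformly
    by [B], in terms of its initial value and the norm of [v]. *)
Lemma weak_defect_bound : exists2 C : R, 0 <= C & forall x v,
  \int[mu]_t scalar_abs (Lp_repr x.1 t - primitive g x.2.1 (Lp_repr v) t)
    <= C * (state_norm k g p1 x + Lp_norm v) /\
  scalar_abs (x.2.2 - primitive g x.2.1 (Lp_repr v) b)
    <= C * (state_norm k g p1 x + Lp_norm v).
Proof.
have [C0 C00 HC] := @L1_le_Lp_norm _ T R k mu p p1 mufin.
pose M : R := fine (mu [set: T]).
have M0 : 0 <= M by exact: fine_ge0 (measure_ge0 _ _).
(* [C0] bounds the term of [u], [M * (1 + 2 * C0)] the primitive integrated over the total mass, and
   [2 + 2 * C0] the defect at [b], where [u_b] contributes 1 and the primitive [1 + 2 * C0]. *)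
exists (C0 + M * (1 + 2 * C0) + (2 + 2 * C0)).
  by have := mulr_ge0 M0 C00; lra.
move=> x v; set al := state_norm k g p1 x; set be := Lp_norm v.
have [n1 n2 n3] : [/\ 0 <= Lp_norm x.1, 0 <= scalar_abs (x.2.1 : F) &
    0 <= scalar_abs (x.2.2 : F)].
  by split; [exact: Lp_norm_ge0|exact: scalar_abs_ge0|exact: scalar_abs_ge0].
have be0 : 0 <= be by exact: Lp_norm_ge0.
have alE : al = Lp_norm x.1 + scalar_abs (x.2.1 : F) + scalar_abs (x.2.2 : F) by [].
pose B := scalar_abs (x.2.1 : F) + 2 * (C0 * be).
have B0 : 0 <= B by rewrite addr_ge0// !mulr_ge0.
have primB t : scalar_abs (primitive g x.2.1 (Lp_repr v) t) <= B.
  by rewrite (le_trans (scalar_abs_primitive_le x.2.1 t (L1 v)))// /B lerD2l ler_pM2l.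
have BE : B <= (1 + 2 * C0) * (al + be).
  rewrite mulrDl mul1r lerD//; first by rewrite alE; lra.
  by rewrite mulrA ler_wpM2l ?mulr_ge0// lerDr alE; lra.
have al0 : 0 <= al by rewrite alE; lra.
have alge : Lp_norm x.1 <= al + be by lra.
have alge2 : scalar_abs (x.2.2 : F) <= al + be by lra.
have ab0 : 0 <= al + be by rewrite addr_ge0.
have absB (z w : F) : scalar_abs (z - w) <= scalar_abs z + scalar_abs w.
  by rewrite -[scalar_abs w]scalar_absN; exact: scalar_absD.
split.
  have intx := in_L1_abs (L1 x.1).
  have intB := stieltjes_integrable_cst g ab B.
  apply: (@le_trans _ _ (\int[mu]_t (scalar_abs (Lp_repr x.1 t) + B))).
    apply: le_Rintegral => //.
    - have -> : (EFin \o (fun t =>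
          scalar_abs (Lp_repr x.1 t - primitive g x.2.1 (Lp_repr v) t))) =
          EFin \o (@scalar_abs R k \o
            ((-1) *: (primitive g x.2.1 (Lp_repr v)) + Lp_repr x.1)).
        by apply/funext => t; rewrite /comp scaleN1_funE.
      exact: (in_L1_abs (in_LpZD (-1) (lexx 1%E)
        (primitive_in_Lp ab x.2.1 (lexx 1%E) (L1 v)) (L1 x.1))).
    - exact: (integrableD measurableT intx intB).
    - by move=> t _; rewrite (le_trans (absB _ _))// lerD2l.
  have cstE : \int[mu]_(t in setT) (cst B t) = B * M.
    exact: (Rintegral_cst mu measurableT B).
  have -> : \int[mu]_t (scalar_abs (Lp_repr x.1 t) + B) =
      \int[mu]_t scalar_abs (Lp_repr x.1 t) + B * M.
    rewrite -cstE.
    exact: (RintegralD measurableT intx intB).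
  have C1e : 0 <= (2 + 2 * C0) * (al + be) by rewrite mulr_ge0// addr_ge0// mulr_ge0.
  have -> : (C0 + M * (1 + 2 * C0) + (2 + 2 * C0)) * (al + be) =
      C0 * (al + be) + (M * ((1 + 2 * C0) * (al + be)) + (2 + 2 * C0) * (al + be)).
    by ring.
  apply: lerD; first exact: le_trans (HC x.1) (ler_wpM2l C00 alge).
  rewrite [leLHS]mulrC; apply: le_trans (ler_wpM2l M0 BE) _.
  by rewrite lerDl.
rewrite (le_trans (absB _ _))//.
rewrite (@le_trans _ _ ((al + be) + (1 + 2 * C0) * (al + be)))//.
  exact: lerD alge2 (le_trans (primB b) BE).
rewrite -{1}(mul1r (al + be)) -mulrDl; apply: ler_wpM2r => //.
by have := mulr_ge0 M0 C00; lra.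
Qed.

(** The pairs of the sequence have zero defect, so by linearity the defect of their difference with
    [(x, y)] is, up to sign, the defect of [(x, y)]. It is independent of [n] and bounded by a
    sequence tending to 0. *)
Lemma state_operator_closed : closed_operator (state_norm k g p1)
  (fun v : Lpg => Lp_norm v) (state_domain k g p1) (state_operator k g p1).
Proof.
move=> x_ x y Dx xcvg ycvg.
suff weak : weak_identity k g p1 x y by split; [exists y|exact: state_operator_eq].
have [C C0 HC] := weak_defect_bound.
set P := primitive g x.2.1 (Lp_repr y).
have L1P : in_Lp mu 1 P by exact: primitive_in_Lp.
have L1D : in_Lp mu 1 ((-1) *: P + Lp_repr x.1) by exact: in_LpZD.
(* A constant below a sequence converging to 0 is nonpositive; this is used for the defect at [b]
   and for the L^1 norm of the defect. *)
have small (r : R) : (forall n, r <= C * (state_norm k g p1 (x_ n - x)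
    + Lp_norm (state_operator k g p1 (x_ n) - y))) -> r <= 0.
  move=> rn.
  have : C * (state_norm k g p1 (x_ n - x)
      + Lp_norm (state_operator k g p1 (x_ n) - y)) @[n --> \oo] --> C * (0 + 0).
    by apply: cvgM; [exact: cvg_cst|exact: cvgD].
  by rewrite addr0 mulr0 => /cvgr_to_ge; apply; exact: nearW.
have key n : weak_identity k g p1 (x_ n) (state_operator k g p1 (x_ n)).
  exact: state_domainP.
have zE n : x_ n - x = (-1) *: x + x_ n by rewrite scaleN1r addrC.
have wE n : state_operator k g p1 (x_ n) - y = (-1) *: y + state_operator k g p1 (x_ n).
  by rewrite scaleN1r addrC.
have primE n t : primitive g (x_ n - x).2.1
      (Lp_repr (state_operator k g p1 (x_ n) - y)) t =
    primitive g (x_ n).2.1 (Lp_repr (state_operator k g p1 (x_ n))) t - P t.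
  rewrite zE wE.
  have := primitive_reprZD (-1) x.2.1 (x_ n).2.1 y
    (state_operator k g p1 (x_ n)) t.
  by move=> ->; rewrite mulN1r addrC.
apply/weak_identityP; rewrite -/P; split; last first.
  have : x.2.2 - P b = 0.
    apply: scalar_abs_le0; apply: small => n.
    have := (HC (x_ n - x) (state_operator k g p1 (x_ n) - y)).2.
    rewrite primE; have /weak_identityP[_ ->] := key n.
    apply: le_trans; rewrite -scalar_absN le_eqVlt; apply/orP; left; apply/eqP.
    by congr scalar_abs; rewrite /=; ring.
  by move/eqP; rewrite subr_eq0 => /eqP.
have : (-1) *: P + Lp_repr x.1 = cst 0 %[ae mu].
  apply: L1_eq0 => //; apply: small => n.
  have := (HC (x_ n - x) (state_operator k g p1 (x_ n) - y)).1.
  apply: le_trans; rewrite le_eqVlt; apply/orP; left; apply/eqP.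
  apply: (ae_eq_Rintegral measurableT (scalar_abs_measurable L1D.1)).
    set z := x_ n - x; set w := state_operator k g p1 (x_ n) - y.
    have L1P' : in_Lp mu 1 (primitive g z.2.1 (Lp_repr w)) by exact: primitive_in_Lp.
    have L1D' : in_Lp mu 1 ((-1) *: primitive g z.2.1 (Lp_repr w) + Lp_repr z.1).
      exact: in_LpZD.
    have := scalar_abs_measurable L1D'.1; congr measurable_fun.
    by apply/funext => t; rewrite /comp scaleN1_funE.
  have /weak_identityP[uE _] := key n.
  apply: filterS2 uE (Lp_reprZD (-1) x.1 (x_ n).1) => t /(_ Logic.I) ut /(_ Logic.I) zt _.
  have {}zt : Lp_repr (x_ n - x).1 t = Lp_repr (x_ n).1 t - Lp_repr x.1 t.
    by rewrite zE -scaleN1_funE.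
  rewrite primE zt ut -scalar_absN; congr scalar_abs.
  by rewrite scaleN1_funE; ring.
apply: filterS => t /(_ Logic.I); rewrite scaleN1_funE.
by move/eqP; rewrite subr_eq0 => /eqP.
Qed.

End weak_identity_theory.

(** * Linearity, closedness, domain and kernel, read off the primitive form of the weak identity *)

Theorem theorem5p5 (R : realType) (k : scalar_kind) (a b : R) (ab : a < b)
    (g : integrator a b) (g_mass : g a < g b) (p : \bar R) (p1 : (1 <= p)%E) :
  [/\ linear_operator (state_domain k g p1) (state_operator k g p1),
      closed_operator (state_norm k g p1)
        (fun v : Lp_space k (stieltjes_measure g) p1 => Lp_norm v)
        (state_domain k g p1) (state_operator k g p1),
      state_domain k g p1 =
        [set x : state_space k g p1 | exists U : R -> scalar_field R k,
          [/\ sobolev g p U,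
              U = Lp_repr x.1 %[ae stieltjes_measure g],
              U a = x.2.1 & U b = x.2.2]] &
      [set x : state_space k g p1 |
          state_domain k g p1 x /\ state_operator k g p1 x = 0] =
        [set x : state_space k g p1 | exists c : scalar_field R k,
          [/\ Lp_repr x.1 = cst c %[ae stieltjes_measure g],
              x.2.1 = c & x.2.2 = c]]].
Proof.
have ab' := ltW ab.
have mufin := stieltjes_measure_lty g ab'.
split.
- split.
    exists 0; apply/(weak_identity0P ab'); split=> //.
    exact: Lp_repr0.
  move=> c x1 x2 D1 D2.
  have W := weak_identityZD ab' c (state_domainP ab' D1) (state_domainP ab' D2).
  by split; [exists (c *: state_operator k g p1 x1 + state_operator k g p1 x2)|
    exact: state_operator_eq].
- exact: state_operator_closed.
- apply/seteqP; split=> x /=.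
    move=> [v /(weak_identityP ab')[uE bE]].
    exists (primitive g x.2.1 (Lp_repr v)); split.
    + exact: (sobolev_primitive ab' x.2.1 p1 (Lp_repr_in_Lp v)).
    + by move: uE; apply: filterS => t /(_ I) ->.
    + exact: primitive_left.
    + exact: bE.
  (* Conversely, the class [V] of the derivative of [U] is the witness: on [[a, b]] the primitive of
     [V] starting at [u_a] is [U] itself. *)
  move=> [U [[_ LU [v [L1v UE] Lv]] Ux Ua Ub]].
  have [V VE] := Lp_repr_surj p1 Lv; exists V; apply/(weak_identityP ab').
  have pE t : t \in `[a, b] -> primitive g x.2.1 (Lp_repr V) t = U t.
    move=> tab; rewrite (UE t tab) Ua.
    by apply: ae_eq_primitive VE; [exact: (Lp_repr_in_L1 mufin V).1|exact: L1v.1].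
  split; last by rewrite pE// in_itv/= ab' lexx.
  (* Agreement on [[a, b[] is agreement almost everywhere, since the complement is null. *)
  have pae : \forall t \ae stieltjes_measure g,
      primitive g x.2.1 (Lp_repr V) t = U t.
    have pI t : a <= t -> t < b -> primitive g x.2.1 (Lp_repr V) t = U t.
      by move=> lat tb; apply: pE; rewrite in_itv/= lat ltW.
    exact: (ae_stieltjes_itv g ab' pI).
  by apply: filterS2 Ux pae => t /(_ I) Uxt Vt _; rewrite Vt Uxt.
- apply/seteqP; split=> x /=.
    move=> [Dx Ax]; have := state_domainP ab' Dx; rewrite Ax.
    move=> /(weak_identity0P ab')[uE cE].
    by exists x.2.1; split; [exact: uE|by []|rewrite cE].
  move=> [c [uE ac bc]].
  have W : weak_identity k g p1 x 0.
    by apply/(weak_identity0P ab'); rewrite ac bc.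
  by split; [exists 0|exact: state_operator_eq].
Qed.
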